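(* Let $(\mathcal{Y}_n)_{n\ge1}$ be the Hollywood process with parameter $(\alpha,\theta,\nu)$, where $\nu$ is a probability distribution on the positive integers, $0<\alpha<1$ and $\theta>-\alpha$. For $n\ge1$ let $p_n(k)=N_k(\mathcal{Y}_n)/v(\mathcal{Y}_n)$, $k\ge1$, be the empirical degree distribution of $\mathcal{Y}_n$. Then for every $k\ge1$, $$p_n(k)\to p_\alpha(k):=\frac{\alpha(1-\alpha)^{\uparrow(k-1)}}{k!}\quad\text{almost surely as }n\to\infty,$$ and $p_\alpha(k)\sim \alpha k^{-(\alpha+1)}/\Gamma(1-\alpha)$ as $k\to\infty$. That is, $(\mathcal{Y}_n)$ has a power law degree distribution with exponent $\gamma=1+\alpha\in(1,2)$.
   Context: Hollywood process with parameter $(\alpha,\theta,\nu)$: generate $X_1,X_2,\dots$ as follows. For each $n$, independently draw $K_n\sim\nu$; given $K_n=k$ choose $X_{n,1},\dots,X_{n,k}$ sequentially. Let $V_n(j)$ be the number of distinct labels among $X_1,\dots,X_{n-1},X_{n,1},\dots,X_{n,j-1}$ (labels $1,2,\dots$ assigned in order of first appearance), and for $i\le V_n(j)$ let $D_{n,j}(i)$ be the number of occurrences of label $i$ among these. Then $\mathrm{pr}(X_{n,j}=i\mid\text{past})\propto D_{n,j}(i)-\alpha$ for $i=1,\dots,V_n(j)$ and $\propto\theta+\alpha V_n(j)$ for $i=V_n(j)+1$. Set $X_n=(X_{n,1},\dots,X_{n,K_n})$ and let $\mathcal{Y}_n$ be the edge-labeled network (vertex labels forgotten, edge labels $1,\dots,n$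 kept) with edges $X_1,\dots,X_n$. For such a network, $v(\mathcal{Y}_n)$ is the number of distinct vertices appearing in its edges and $N_k(\mathcal{Y}_n)$ is the number of vertices whose total number of appearances (counted with multiplicity over all edges) equals $k$. $x^{\uparrow j}=x(x+1)\cdots(x+j-1)$ and $\Gamma$ is the gamma function. A sequence has a power law degree distribution with exponent $\gamma>1$ if its degree proportions satisfy $d_k\sim\ell(k)k^{-\gamma}$ for large $k$ with $\ell$ slowly varying. *)

(* Defs.v *)
From HB Require Import structures.
From mathcomp Require Import all_boot all_order all_algebra.
From mathcomp Require Import all_classical all_reals all_analysis.
Set Implicit Arguments. Unset Strict Implicit. Unset Printing Implicit Defensive.
Import Order.TTheory GRing.Theory Num.Theory.
Import numFieldNormedType.Exports.
Local Open Scope classical_set_scope.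
Local Open Scope ring_scope.

Definition rising {R : realType} (x : R) (j : nat) : R :=
  \prod_(i < j) (x + i%:R).

Definition Gamma {R : realType} (s : R) : R :=
  fine (\int[@lebesgue_measure R]_(x in `]0%R, +oo[)
          ((x `^ (s - 1)) * expR (- x))%:E)%E.

Definition nlabels (s : seq nat) : nat := size (undup s).
Definition occ (s : seq nat) (i : nat) : nat := count_mem i s.

(* conditional probability that the next label is x, given past labels s.
   Labels are 1,2,... in order of first appearance.  Weight of an old label
   i (1 <= i <= V) is D(i) - alpha, weight of the new label V+1 is
   theta + alpha V; the probability is weight / total weight.  The very first
   label (empty past) is label 1 with probability 1. *)
Definition hw_step {R : realType} (alpha theta : R) (s : seq nat) (x : nat) : R :=
  let V := nlabels s in
  let tot := (\sum_(1 <= i < V.+1) ((occ s i)%:R - alpha)) + (theta + alpha * V%:R) in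
  if s is [::] then (x == 1%N)%:R
  else if (1 <= x <= V)%N then ((occ s x)%:R - alpha) / tot
  else if x == V.+1 then (theta + alpha * V%:R) / tot
  else 0.

Fixpoint hw_seq_aux {R : realType} (alpha theta : R) (past : seq nat) (z : seq nat) : R :=
  match z with
  | [::] => 1
  | x :: z' => hw_step alpha theta past x * hw_seq_aux alpha theta (rcons past x) z'
  end.
Definition hw_seq_prob {R : realType} (alpha theta : R) (z : seq nat) : R :=
  hw_seq_aux alpha theta [::] z.

Definition prob_on_pos {R : realType} (nu : nat -> R) : Prop :=
  nu 0%N = 0 /\ (forall k, 0 <= nu k) /\ (series nu @ \oo --> (1 : R)).

(* X : nat -> T -> seq nat, where X i is the edge X_{i+1} = (X_{i+1,1},...,X_{i+1,K_{i+1}})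
   is a Hollywood process with parameter (alpha, theta, nu) on the probability P:
   each X i is a (discrete) random variable, and the joint law of the first
   edges is: K_i i.i.d. ~ nu, labels chosen sequentially by hw_step. *)
Definition hollywood {R : realType} d (T : measurableType d) (P : probability T R)
  (alpha theta : R) (nu : nat -> R) (X : nat -> T -> seq nat) : Prop :=
  (forall i (s : seq nat), measurable (X i @^-1` [set s])) /\
  (forall xs : seq (seq nat),
     P [set w | forall i, (i < size xs)%N -> X i w = nth [::] xs i]
     = ((\prod_(x <- xs) nu (size x)) * hw_seq_prob alpha theta (flatten xs))%:E).

Definition appearances (X : nat -> seq nat) (n : nat) : seq nat :=
  flatten [seq X i | i <- iota 0 n].
Definition nvert (s : seq nat) : nat := size (undup s).
Definition Ndeg (s : seq nat) (k : nat) : nat :=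
  count (fun v => count_mem v s == k) (undup s).
Definition emp_deg {R : realType} (X : nat -> seq nat) (n k : nat) : R :=
  (Ndeg (appearances X n) k)%:R / (nvert (appearances X n))%:R.

Definition p_alpha {R : realType} (alpha : R) (k : nat) : R :=
  alpha * rising (1 - alpha) k.-1 / (k`!)%:R.

Definition slowly_varying {R : realType} (l : R -> R) : Prop :=
  (\forall x \near +oo, 0 < l x) /\
  forall lam : R, 0 < lam -> (fun x => l (lam * x) / l x) @ +oo --> (1 : R).

Definition power_law {R : realType} (dk : nat -> R) (gamma : R) : Prop :=
  1 < gamma /\ exists l : R -> R, slowly_varying l /\
    (fun k : nat => dk k / (l k%:R * (k%:R `^ (- gamma)))) @ \oo --> (1 : R).

(* Main.v *)
(* Condition on the edge sizes: the concatenated labels are then a Chinese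
   restaurant sequence whose length L, after n edges, is at least n, so it
   suffices to bound probabilities under the sequential rule at fixed length,
   uniformly in L >= n.

   Let V be the number of labels, t = L + theta the total weight and, for
   f : nat -> R, let S_f be the sum of f over the degrees.  The one-step drift
   of S_f is compensated by letting f evolve backwards in time by [flow].  This
   evolution multiplies the p_alpha-mean of f by 1 + alpha / t and, being a
   convex combination plus a constant, does not increase its oscillation; hence
   a centred f stays bounded along the flow.  Consequently
   exp(S_f - psi V) + A / V, with psi of the order of the square of the
   oscillation, is a supermartingale, and |N_k - p_alpha(k) V| > delta V has
   probability at most C exp(- c x) on the event V >= x.  Moreover E(1 / V)
   decays polynomially, so V grows at least like a power of n: Borel-Cantelli
   along n = 2 ^ j gives this growth (V is monotone), and Borel-Cantelli along
   all n then gives the degree proportions.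

   The asymptotics of p_alpha is Wendel's inequality
   Gamma(s + t) <= s ^ t Gamma(s), 0 < t < 1, obtained by integrating the
   tangent to x |-> x ^ t at x = s, together with Gamma(s + 1) = s Gamma(s). *)

Require Import Defs.
From HB Require Import structures.
From mathcomp Require Import all_boot all_order all_algebra.
From mathcomp Require Import all_classical all_reals all_analysis.
From mathcomp Require Import measurable_realfun.
From mathcomp Require Import ring lra zify.
Import Order.TTheory GRing.Theory Num.Theory.
Import numFieldNormedType.Exports.
Local Open Scope classical_set_scope.
Local Open Scope ring_scope.
Set Implicit Arguments. Unset Strict Implicit. Unset Printing Implicit Defensive.

(** * Label sequences and the one-step kernel *)

Lemma nlabels_rcons (s : seq nat) x :
  nlabels (rcons s x) = (nlabels s + (x \notin s))%N.
Proof.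
rewrite /nlabels undup_rcons size_rcons size_filter.
have := count_predC (pred1 x) (undup s).
have -> : count (predC (pred1 x)) (undup s) = count (fun y => y != x) (undup s) by [].
rewrite (count_uniq_mem _ (undup_uniq s)) mem_undup.
by case: (x \in s) => /= <-; rewrite ?addn0 ?addn1 ?add0n ?add1n.
Qed.

Lemma nlabels_gt0 (s : seq nat) : s != [::] -> (0 < nlabels s)%N.
Proof.
case: s => [//|x s] _; rewrite /nlabels -has_predT; apply/hasP; exists x => //.
by rewrite mem_undup mem_head.
Qed.

Lemma nlabels_le_size (s : seq nat) : (nlabels s <= size s)%N.
Proof. exact: size_undup. Qed.

(** Invariant kept by the sequential rule. Under it sums over [undup s] become sums over 1..V, the
    range used in the normalisation of [hw_step]. *)
Definition labelled (s : seq nat) : Prop :=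
  forall i, (i \in s) = (0 < i <= nlabels s)%N.

Lemma labelled_nil : labelled [::].
Proof. by case. Qed.

Lemma labelled_rcons s x : labelled s -> (0 < x <= (nlabels s).+1)%N ->
  labelled (rcons s x).
Proof.
move=> sl xV i; rewrite mem_rcons in_cons nlabels_rcons !sl; lia.
Qed.

Lemma perm_undup_labelled s : labelled s ->
  perm_eq (undup s) (iota 1 (nlabels s)).
Proof.
move=> sl; apply: uniq_perm; rewrite ?undup_uniq ?iota_uniq// => i.
by rewrite mem_undup sl mem_iota; lia.
Qed.

Section hollywood_kernel.
Context {R : realType} (alpha theta : R).
Implicit Types (s : seq nat) (f : nat -> R) (g : seq nat -> R).

Definition degsum f s : R := \sum_(v <- undup s) f (occ s v).

Lemma degsum_labelled f s : labelled s ->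
  degsum f s = \sum_(1 <= i < (nlabels s).+1) f (occ s i).
Proof.
move=> sl; rewrite /degsum (perm_big _ (perm_undup_labelled sl)) /=.
by rewrite /index_iota subSS subn0.
Qed.

Lemma occ_rcons s x i : occ (rcons s x) i = (occ s i + (x == i))%N.
Proof. by rewrite /occ -cats1 count_cat /= addn0. Qed.

Lemma occ_gt0 s i : (0 < occ s i)%N = (i \in s).
Proof. by rewrite /occ -has_count has_pred1. Qed.

Lemma degsum_old f s x : labelled s -> (0 < x <= nlabels s)%N ->
  degsum f (rcons s x) = degsum f s + (f (occ s x).+1 - f (occ s x)).
Proof.
move=> sl xV; have xs : x \in s by rewrite sl.
have V1 : nlabels (rcons s x) = nlabels s by rewrite nlabels_rcons xs addn0.
rewrite !degsum_labelled//; last by apply: labelled_rcons => //; lia.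
rewrite V1 (@bigD1_seq _ _ _ _ _ x) ?mem_index_iota ?iota_uniq//=.
rewrite [in RHS](@bigD1_seq _ _ _ _ _ x) ?mem_index_iota ?iota_uniq//=.
rewrite occ_rcons eqxx addn1.
under eq_bigr => i ix do rewrite occ_rcons eq_sym (negbTE ix) addn0.
ring.
Qed.

Lemma nlabels_old s x : labelled s -> (0 < x <= nlabels s)%N ->
  nlabels (rcons s x) = nlabels s.
Proof. by move=> sl xV; rewrite nlabels_rcons sl xV addn0. Qed.

Lemma nlabels_new s : labelled s ->
  nlabels (rcons s (nlabels s).+1) = (nlabels s).+1.
Proof. by move=> sl; rewrite nlabels_rcons sl ltnn andbF addn1. Qed.

Lemma degsum_new f s : labelled s ->
  degsum f (rcons s (nlabels s).+1) = degsum f s + f 1%N.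
Proof.
move=> sl; rewrite !degsum_labelled//; last by apply: labelled_rcons => //; lia.
rewrite nlabels_new// big_nat_recr//= occ_rcons eqxx addn1; congr (_ + f _.+1).
  apply: eq_big_nat => i iV; rewrite occ_rcons.
  rewrite (_ : (nlabels s).+1 == i = false); last by apply/negbTE; lia.
  by rewrite addn0.
by apply/eqP; rewrite -leqn0 leqNgt occ_gt0 sl ltnn andbF.
Qed.

Lemma sum_occ s : labelled s ->
  \sum_(1 <= i < (nlabels s).+1) (occ s i)%:R = (size s)%:R :> R.
Proof.
move=> sl; rewrite -(degsum_labelled (fun d => d%:R))// /degsum -natr_sum.
congr (_%:R); rewrite -sum1_size -[RHS]big_undup_iterop_count/=.
by apply: eq_bigr => i _; rewrite Monoid.iteropE iter_addn_0 mul1n.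
Qed.

(** Expectations are iterated finite sums, so the label rule is analysed without a probability
    space; [edges_law] later connects [hwE] with P. *)
Definition kern g s : R :=
  \sum_(1 <= x < (nlabels s).+2) hw_step alpha theta s x * g (rcons s x).

Fixpoint hwE n g s : R := if n is n'.+1 then kern (hwE n' g) s else g s.

Hypotheses (alpha_gt0 : 0 < alpha) (alpha_lt1 : alpha < 1) (theta_gt : - alpha < theta).

Let tot_gt0 s : labelled s -> s != [::] -> 0 < (size s)%:R + theta.
Proof.
case: s => // x s _ _ /=; have : (1 : R) <= (size s).+1%:R by rewrite ler1n.
by move=> ?; move: alpha_gt0 alpha_lt1 theta_gt; lra.
Qed.

Lemma hw_step_old s x : labelled s -> (0 < x <= nlabels s)%N ->
  hw_step alpha theta s x = ((occ s x)%:R - alpha) / ((size s)%:R + theta).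
Proof.
move=> sl xV; have : s != [::] by case: (s) xV => //=; case: x.
case: s sl xV => [//|y s] sl xV _; rewrite /hw_step xV; congr (_ / _).
rewrite sumrB sum_occ// sumr_const_nat subSS subn0 mulr_natr; ring.
Qed.

Lemma hw_step_new s : labelled s -> s != [::] ->
  hw_step alpha theta s (nlabels s).+1 =
  (theta + alpha * (nlabels s)%:R) / ((size s)%:R + theta).
Proof.
case: s => [//|y s] sl _; rewrite /hw_step eqxx ltnn andbF; congr (_ / _).
rewrite sumrB sum_occ// sumr_const_nat subSS subn0 mulr_natr; ring.
Qed.

Lemma kernE g s : labelled s -> s != [::] ->
  kern g s = \sum_(1 <= x < (nlabels s).+1)
     ((occ s x)%:R - alpha) / ((size s)%:R + theta) * g (rcons s x) +
   (theta + alpha * (nlabels s)%:R) / ((size s)%:R + theta) *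
     g (rcons s (nlabels s).+1).
Proof.
move=> sl s0; rewrite /kern big_nat_recr//= hw_step_new//; congr (_ + _).
by apply: eq_big_nat => x xV; rewrite hw_step_old.
Qed.

Lemma kern_nil g : kern g [::] = g [:: 1%N].
Proof. by rewrite /kern big_nat1 /= mul1r. Qed.

Lemma hw_step_ge0 s x : labelled s -> (0 < x < (nlabels s).+2)%N ->
  0 <= hw_step alpha theta s x.
Proof.
move=> sl; have [->|s0] := eqVneq s [::]; first by move=> _; rewrite /= ler0n.
rewrite ltnS [(x <= _)%N]leq_eqVlt ltnS => /andP[x0 /orP[/eqP->|xV]].
  rewrite hw_step_new// divr_ge0//; last exact/ltW/tot_gt0.
  (* A nonempty past has V >= 1, so theta + alpha V >= theta + alpha > 0 even when theta is
     negative. *)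
  have : (1 : R) <= (nlabels s)%:R by rewrite ler1n nlabels_gt0.
  by move=> ?; move: alpha_gt0 alpha_lt1 theta_gt; nra.
rewrite hw_step_old ?x0// divr_ge0//; last exact/ltW/tot_gt0.
have : (1 : R) <= (occ s x)%:R by rewrite ler1n occ_gt0 sl x0.
by move=> ?; move: alpha_gt0 alpha_lt1 theta_gt; lra.
Qed.

Lemma sum_weight s : labelled s ->
  \sum_(1 <= x < (nlabels s).+1) ((occ s x)%:R - alpha) =
  (size s)%:R - alpha * (nlabels s)%:R.
Proof.
by move=> sl; rewrite sumrB sum_occ// sumr_const_nat subSS subn0 mulr_natr.
Qed.

Lemma kern_cst c s : labelled s -> kern (fun=> c) s = c.
Proof.
move=> sl; have [->|s0] := eqVneq s [::]; first by rewrite kern_nil.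
have t0 := tot_gt0 sl s0.
rewrite kernE// -mulr_suml -mulr_suml sum_weight//; field.
exact: lt0r_neq0.
Qed.

Lemma le_kern g1 g2 s : labelled s ->
  (forall s', labelled s' -> size s' = (size s).+1 -> g1 s' <= g2 s') ->
  kern g1 s <= kern g2 s.
Proof.
move=> sl g12; apply: ler_sum_nat => x xV; apply: ler_wpM2l.
  exact: hw_step_ge0.
by apply: g12; [apply: labelled_rcons|rewrite size_rcons].
Qed.

Lemma le_hwE n g1 g2 s : labelled s ->
  (forall s', labelled s' -> size s' = (size s + n)%N -> g1 s' <= g2 s') ->
  hwE n g1 s <= hwE n g2 s.
Proof.
elim: n s => [|n IH] s sl g12 /=; first by apply: g12; rewrite ?addn0.
apply: le_kern => // s' s'l s's; apply: IH => // s'' s''l; rewrite s's => s''s.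
by apply: g12 => //; rewrite s''s; lia.
Qed.

Lemma hwE_cst n c s : labelled s -> hwE n (fun=> c) s = c.
Proof.
elim: n s => //= n IH s sl; rewrite -[RHS](kern_cst c sl).
by apply/eqP; rewrite eq_le !le_kern// => s' s'l _; rewrite IH.
Qed.

Lemma hwE_addn m n g s : hwE (m + n) g s = hwE m (hwE n g) s.
Proof.
elim: m s => //= m IH s; congr kern; exact/funext.
Qed.

(** [G] depends on the elapsed time because both applications need it: a growing power of the length
    in [hwE_invV], a test function flowing backwards in [hwE_exp_bound]. *)
Lemma hwE_supermartingale (G : nat -> seq nat -> R) n s :
  labelled s ->
  (forall i s', (i < n)%N -> labelled s' -> size s' = (size s + i)%N ->
    kern (G i.+1) s' <= G i s') ->
  hwE n (G n) s <= G 0%N s.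
Proof.
elim: n G s => [//|n IH] G s sl GG /=.
apply: (le_trans _ (GG 0%N s _ sl _)) => //; last by rewrite addn0.
apply: le_kern => // s' s'l s's; apply: (IH (fun i => G i.+1)) => // i s'' iltn s''l s''s.
by apply: GG => //; rewrite s''s s's; lia.
Qed.

End hollywood_kernel.

(** * Exponential supermartingale *)

Section real_bounds.
Context {R : realType}.

(** exp x <= 1 / (1 - x), and (1 + x + 2 x^2)(1 - x) = 1 + x^2 (1 - 2 x) >= 1. *)
Lemma expR_le_quad (x : R) : x <= 1 / 2 -> expR x <= 1 + x + 2 * x ^+ 2.
Proof.
move=> x2; have x1 : 0 < 1 - x by lra.
have : expR x <= (1 - x)^-1.
  rewrite -[x in expR x]opprK expRN lef_pV2 ?posrE ?expR_gt0//.
  exact: expR_ge1Dx.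
move/le_trans; apply.
rewrite -[leLHS]mul1r ler_pdivrMr// expr2; nra.
Qed.

Lemma expRN_le_half (x : R) : 0 <= x <= 1 -> expR (- x) <= 1 - x / 2.
Proof.
move=> /andP[x0 x1]; apply: (@le_trans _ _ (1 + x)^-1).
  by rewrite expRN lef_pV2 ?posrE ?expR_gt0 ?expR_ge1Dx//; lra.
rewrite -[leLHS]mul1r ler_pdivrMr; last lra.
nra.
Qed.

(** As m + th <= (1 + |th|) m, the loss rho / (m + th) is at least rho' / m, which pays for the
    growth (1 + 1 / m)^rho' <= exp(rho' / m). *)
Lemma powR_step (m rho rho' th : R) : 1 <= m -> 0 < m + th ->
  0 < rho' -> rho' * (1 + `|th|) <= rho ->
  (m + 1) `^ rho' * (1 - rho / (m + th)) <= m `^ rho'.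
Proof.
move=> m1 mt r'0 r'r; have m0 : 0 < m by lra.
have -> : m + 1 = m * (1 + m^-1) by field; exact: lt0r_neq0.
have mV : 0 < m^-1 by rewrite invr_gt0.
rewrite powRM ?(ltW m0)//; last by lra.
rewrite -mulrA ger_pMr ?powR_gt0//.
have h1 : (1 + m^-1) `^ rho' <= expR (rho' / m).
  rewrite /powR ifF; last by apply/negbTE/lt0r_neq0; lra.
  rewrite ler_expR ler_pM2l//.
  by apply: le_ln1Dx; lra.
have h2 : 1 - rho / (m + th) <= expR (- (rho' / m)).
  apply: (le_trans (expR_ge1Dx _)); rewrite ler_expR lerN2.
  rewrite ler_pdivrMr// mulrAC ler_pdivlMr//.
  apply: (@le_trans _ _ (rho' * (1 + `|th|) * m)); last by rewrite ler_wpM2r// ltW.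
  rewrite -mulrA ler_pM2l//; have := ler_norm th; have := normr_ge0 th; nra.
have [h3|h3] := leP (1 - rho / (m + th)) 0.
  by apply: (@le_trans _ _ 0); rewrite ?ler01// mulr_ge0_le0 ?powR_ge0.
apply: (le_trans (ler_pM (powR_ge0 _ _) (ltW h3) h1 h2)).
by rewrite -expRD subrr expR0.
Qed.

End real_bounds.

Section supermartingales.
Context {R : realType} (alpha theta rho : R).
Hypotheses (alpha_gt0 : 0 < alpha) (alpha_lt1 : alpha < 1).
Hypotheses (theta_gt : - alpha < theta).
Hypotheses (rho_gt0 : 0 < rho) (rho_le : 2 * rho <= alpha)
  (rho_le' : 2 * rho <= theta + alpha).
Implicit Types (s : seq nat) (f : nat -> R) (g : seq nat -> R).

Let tot_gt0 s : s != [::] -> 0 < (size s)%:R + theta.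
Proof.
case: s => // x s _ /=; have : (1 : R) <= (size s).+1%:R by rewrite ler1n.
by move=> ?; move: alpha_gt0 alpha_lt1 theta_gt; lra.
Qed.

(** The weight of a new label is of order V: it equals (theta + alpha) + alpha (V - 1), and both
    theta + alpha and alpha are at least 2 rho. *)
Let new_ge s : s != [::] ->
  2 * rho * (nlabels s)%:R <= theta + alpha * (nlabels s)%:R.
Proof.
move=> s0; have : (1 : R) <= (nlabels s)%:R by rewrite ler1n nlabels_gt0.
by move=> ?; move: rho_le rho_le'; nra.
Qed.

(** With u the weight of a new label and t the total weight, the mean of 1 / V drops by u / (t V (V
    + 1)), and u >= 2 rho V >= rho (V + 1). *)
Lemma kern_invV s : labelled s -> s != [::] ->
  kern alpha theta (fun s => (nlabels s)%:R^-1) s <=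
  (1 - rho / ((size s)%:R + theta)) / (nlabels s)%:R.
Proof.
move=> sl s0; have t0 := tot_gt0 s0; rewrite kernE//.
under eq_big_nat => x xV do rewrite nlabels_old//.
rewrite nlabels_new// -mulr_suml -mulr_suml sum_weight//.
have V1 : (1 : R) <= (nlabels s)%:R by rewrite ler1n nlabels_gt0.
have u0 := new_ge s0; rewrite -natr1.
set V : R := (nlabels s)%:R in V1 u0 *; set m : R := (size s)%:R in t0 *.
rewrite -subr_ge0.
have -> : (1 - rho / (m + theta)) / V - ((m - alpha * V) / (m + theta) / V +
   (theta + alpha * V) / (m + theta) / (V + 1)) =
   ((theta + alpha * V) - rho * (V + 1)) / ((m + theta) * V * (V + 1)).
  by field; rewrite !lt0r_neq0//; lra.
apply: divr_ge0; last by rewrite !mulr_ge0//; lra.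
by move: rho_gt0; nra.
Qed.

Lemma hwE_invV rho' n : 0 < rho' -> rho' * (1 + `|theta|) <= rho ->
  hwE alpha theta n.+1 (fun s => n.+1%:R `^ rho' / (nlabels s)%:R) [::] <= 1.
Proof.
move=> r'0 r'r.
rewrite /= kern_nil.
pose G i s : R := i.+1%:R `^ rho' / (nlabels s)%:R.
have G0 : G 0%N [:: 1%N] = 1 by rewrite /G powR1 divr1.
have sl1 : labelled [:: 1%N] by move=> [|[|i]]; rewrite // in_cons.
rewrite -[leRHS]G0.
apply: (@hwE_supermartingale _ _ _ alpha_gt0 alpha_lt1 theta_gt G) => //.
move=> i s iln sl ss; have s0 : s != [::] by case: (s) ss.
have -> : kern alpha theta (G i.+1) s =
    i.+2%:R `^ rho' * kern alpha theta (fun s => (nlabels s)%:R^-1) s.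
  by rewrite /kern mulr_sumr; apply: eq_bigr => x _; rewrite mulrCA.
apply: (le_trans (ler_wpM2l (powR_ge0 _ _) (kern_invV sl s0))).
rewrite mulrA /G ler_wpM2r ?invr_ge0 ?ler0n//.
have t0 := tot_gt0 s0; move: t0; rewrite ss /= add1n => t0.
rewrite -natr1; apply: powR_step => //; first by rewrite ler1n.
Qed.

(** Backward equation: the degree sum of [flow (size s) f] is the conditional mean of that of [f]
    after the next label, up to theta f(1) / (m + theta). The term alpha f(1) spreads the part alpha
    V of the new label's weight over the V existing labels, so that the result is again a degree
    sum. *)
Definition flow (m : nat) f (d : nat) : R :=
  f d + ((d%:R - alpha) * (f d.+1 - f d) + alpha * f 1%N) / (m%:R + theta).

Lemma degsum_flow f s : degsum (flow (size s) f) s =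
  degsum f s + (\sum_(v <- undup s)
     ((occ s v)%:R - alpha) * (f (occ s v).+1 - f (occ s v)) +
   alpha * (nlabels s)%:R * f 1%N) / ((size s)%:R + theta).
Proof.
rewrite /degsum /flow big_split/= -mulr_suml big_split/=.
by rewrite big_const_seq count_predT iter_addr_0 -[_ *+ size _]mulr_natr mulrAC.
Qed.


Lemma degsum_le f w s : (forall d, (0 < d)%N -> f d <= w) ->
  degsum f s <= w * (nlabels s)%:R.
Proof.
move=> fw; rewrite /degsum /nlabels.
have -> : w * (size (undup s))%:R = \sum_(v <- undup s) w.
  by rewrite big_const_seq count_predT iter_addr_0 mulr_natr.
rewrite big_seq [leRHS]big_seq; apply: ler_sum => v; rewrite mem_undup => vs.
by apply: fw; rewrite occ_gt0.
Qed.

(** Let S' be the degree sum of the flowed f and S_f = S' + b. In the second-order expansion of the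
    exponential, b cancels the drift up to theta f(1) / t. The quadratic terms are of order w^2 V /
    t, since f is constant from K on; the penalty psi on a new label gains at least rho psi V / (2
    t). In the lower bound on psi the summands in K^2, in K and in |theta| + 1 pay for b^2, for the
    increments at old labels and for f(1)^2; the last 1 leaves the surplus - w^2 V / t. *)
Lemma kern_exp_step f K w psi s : labelled s ->
  (0 < K <= size s)%N ->
  (forall d, (K <= d)%N -> f d.+1 = f d) ->
  (forall d, (0 < d)%N -> `|f d| <= w) ->
  10 * K%:R * w <= 1 - alpha -> 0 <= psi <= 1 ->
  (4 * (9 * K%:R ^+ 2 / (1 - alpha) + 4 * K%:R + `|theta| + 1) + 1) * w ^+ 2
    <= rho * psi / 2 ->
  kern alpha theta (fun s => expR (degsum f s - psi * (nlabels s)%:R)) s <=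
  expR (degsum (flow (size s) f) s - psi * (nlabels s)%:R) *
  (1 + (`|theta| * w - w ^+ 2 * (nlabels s)%:R) / ((size s)%:R + theta)).
Proof.
move=> sl /andP[K0 Km] fK fw wsmall psi01 psibig.
have s0 : s != [::] by case: (s) Km K0 => //=; case: K {fK wsmall psibig}.
have t0 := tot_gt0 s0; have u2 := new_ge s0.
have V1 : (1 : R) <= (nlabels s)%:R by rewrite ler1n nlabels_gt0.
have Vm : (nlabels s)%:R <= (size s)%:R :> R by rewrite ler_nat nlabels_le_size.
rewrite kernE//.
pose g i := f (occ s i).+1 - f (occ s i).
pose c i : R := (occ s i)%:R - alpha.
pose G1 := \sum_(1 <= i < (nlabels s).+1) c i * g i.
pose G2 := \sum_(1 <= i < (nlabels s).+1) c i * (g i) ^+ 2.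
set V : R := (nlabels s)%:R in V1 Vm u2 *.
set m : R := (size s)%:R in Vm t0 *; set t := m + theta in t0 *.
have w0 : 0 <= w by apply: le_trans (fw 1%N isT).
have K1 : (1 : R) <= K%:R by rewrite ler1n.
have f1 := fw 1%N isT; set y := f 1%N in f1 *.
pose b := - (G1 + alpha * V * y) / t.
have bE : t * b = - (G1 + alpha * V * y) by rewrite /b; field; exact: lt0r_neq0.
have degE : degsum f s = degsum (flow (size s) f) s + b.
  rewrite degsum_flow (_ : \sum_(v <- undup s) _ = G1); last first.
    exact: (degsum_labelled (fun d => (d%:R - alpha) * (f d.+1 - f d))).
  by rewrite -/t -/V -/y /b; ring.
set S' := degsum (flow _ _) _ in degE *.
have c_ge0 i : (1 <= i < (nlabels s).+1)%N -> 0 <= c i.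
  move=> iV; have : (1 : R) <= (occ s i)%:R by rewrite ler1n occ_gt0 sl.
  by move=> ?; move: alpha_lt1; rewrite /c; lra.
have g_le i : (1 <= i < (nlabels s).+1)%N -> `|g i| <= 2 * w.
  move=> iV; apply: (le_trans (ler_normB _ _)).
  have := fw (occ s i).+1 isT; have : `|f (occ s i)| <= w.
    by apply: fw; rewrite occ_gt0 sl.
  by lra.
(* From degree K on the increment vanishes; below K the weight is at most K. *)
have cg_le i : (1 <= i < (nlabels s).+1)%N -> c i * `|g i| <= 2 * K%:R * w.
  move=> iV; have [oK|oK] := leqP K (occ s i).
    by rewrite /g fK// subrr normr0 mulr0; nra.
  have cK : c i <= K%:R.
    have : (occ s i)%:R <= K%:R :> R by rewrite ler_nat ltnW.
    by move=> ?; move: alpha_gt0; rewrite /c; lra.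
  have := g_le i iV; have := c_ge0 i iV; have := normr_ge0 (g i); nra.
have sumV (a : R) : \sum_(1 <= i < (nlabels s).+1) a = a * V.
  by rewrite sumr_const_nat subSS subn0 mulr_natr.
have G1_le : `|G1| <= 2 * K%:R * w * V.
  apply: (le_trans (ler_norm_sum _ _ _)); rewrite -sumV; apply: ler_sum_nat => i iV.
  by rewrite normrM (ger0_norm (c_ge0 _ iV)) cg_le.
have G2_le : G2 <= 4 * K%:R * w ^+ 2 * V.
  rewrite -sumV; apply: ler_sum_nat => i iV.
  rewrite -real_normK ?num_real// expr2 mulrA.
  apply: (@le_trans _ _ (2 * K%:R * w * (2 * w))); last by rewrite expr2; lra.
  by apply: ler_pM; rewrite ?g_le ?cg_le ?mulr_ge0 ?c_ge0.
have tb_le : `|t * b| <= 3 * K%:R * w * V.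
  rewrite bE normrN; apply: (le_trans (ler_normD _ _)).
  have : `|alpha * V * y| <= w * V.
    rewrite !normrM (gtr0_norm alpha_gt0) (@ger0_norm _ V); last by lra.
    have : alpha * `|y| <= w by move: alpha_lt1 alpha_gt0; have := normr_ge0 y; nra.
    by nra.
  have : w * V <= K%:R * w * V by rewrite ler_wpM2r//; nra.
  by lra.
(* Needed to divide the bound on t b by t: t - (1 - alpha) V = (m - V) + theta + alpha V. *)
have Vt : (1 - alpha) * V <= t.
  by rewrite /t; move: alpha_gt0 theta_gt; nra.
have a1 : 0 < 1 - alpha by move: alpha_lt1; lra.
have b_le : `|b| * (1 - alpha) <= 3 * K%:R * w.
  have V0 : 0 < V by lra.
  rewrite -(ler_pM2r V0) -[leLHS]mulrA.
  apply: le_trans _ tb_le; rewrite (normrM t b) (gtr0_norm t0) mulrC.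
  by rewrite ler_wpM2r.
have Kw0 : 0 <= K%:R * w by nra.
(* Keeps every exponent b + z with |z| <= 2 w below 1/2, as [expR_le_quad] requires. *)
have bsmall : `|b| <= 1 / 2 - 2 * w.
  rewrite -(ler_pM2r a1); apply: (le_trans b_le).
  have : w <= K%:R * w by nra.
  have : (1 - alpha) * w <= w by move: alpha_gt0; nra.
  by lra.
have exp_le (z : R) : `|z| <= 2 * w ->
    expR (b + z) <= 1 + b + z + 4 * b ^+ 2 + 4 * z ^+ 2.
  move=> zw; apply: (le_trans (expR_le_quad _)).
    by have := ler_norm b; have := ler_norm z; lra.
  have := sqr_ge0 (b - z); rewrite !expr2; nra.
(* With this lower bound the factor 1 - psi / 2 takes off at least psi / 4. *)
have lower : 1 / 2 <= expR (b + y).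
  apply: le_trans (expR_ge1Dx _).
  by have := lerNnormlW (lexx `|b|); have := lerNnormlW (lexx `|y|); lra.
have expnew : expR (b + y - psi) <= 1 + b + y + 4 * b ^+ 2 + 4 * y ^+ 2 - psi / 4.
  rewrite expRD; have /expRN_le_half h : 0 <= psi <= 1 by [].
  apply: (@le_trans _ _ (expR (b + y) * (1 - psi / 2))).
    by rewrite ler_wpM2l// expR_ge0.
  have : expR (b + y) <= 1 + b + y + 4 * b ^+ 2 + 4 * y ^+ 2.
    by apply: exp_le; lra.
  by case/andP: psi01; nra.
have u0 : 0 <= theta + alpha * V by move: rho_gt0; nra.
rewrite nlabels_new// degsum_new// -natr1 -/V -/y degE.
have -> : S' + b + y - psi * (V + 1) = (S' - psi * V) + (b + y - psi) by ring.
rewrite expRD.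
have -> : \sum_(1 <= x < (nlabels s).+1) ((occ s x)%:R - alpha) / t *
    expR (degsum f (rcons s x) - psi * (nlabels (rcons s x))%:R) =
  expR (S' - psi * V) / t * \sum_(1 <= x < (nlabels s).+1) c x * expR (b + g x).
  rewrite mulr_sumr; apply: eq_big_nat => i iV.
  rewrite degsum_old// nlabels_old// degE.
  have -> : S' + b + (f (occ s i).+1 - f (occ s i)) - psi * (nlabels s)%:R =
    (S' - psi * V) + (b + g i) by rewrite /g /V; ring.
  by rewrite expRD /c; ring.
have sum_le : \sum_(1 <= x < (nlabels s).+1) c x * expR (b + g x) <=
    (m - alpha * V) * (1 + b + 4 * b ^+ 2) + G1 + 4 * G2.
  rewrite -(sum_weight _ sl) mulr_suml [4 * G2]mulr_sumr -!big_split/=.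
  apply: ler_sum_nat => i iV.
  apply: (le_trans (ler_wpM2l (c_ge0 i iV) (exp_le _ (g_le i iV)))).
  by rewrite -/(c i) le_eqVlt; apply/orP; left; apply/eqP; ring.
set E := expR (S' - psi * V).
have E0 : 0 < E by exact: expR_gt0.
have new_le : (theta + alpha * V) * expR (b + y - psi) <=
    (theta + alpha * V) * (1 + b + y + 4 * b ^+ 2 + 4 * y ^+ 2 - psi / 4).
  by rewrite ler_wpM2l.
set Sum := \sum_(_ <= _ < _) _ in sum_le *.
have -> : E / t * Sum + (theta + alpha * V) / t * (E * expR (b + y - psi)) =
  E * ((Sum + (theta + alpha * V) * expR (b + y - psi)) / t) by ring.
rewrite ler_pM2l// ler_pdivrMr// [leRHS]mulrDl mul1r divfK; last exact: lt0r_neq0.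
apply: (le_trans (lerD sum_le new_le)).
(* The weights add up to t; by [bE], t b + G1 + (theta + alpha V) y reduces to theta y. *)
have -> : (m - alpha * V) * (1 + b + 4 * b ^+ 2) + G1 + 4 * G2 +
   (theta + alpha * V) * (1 + b + y + 4 * b ^+ 2 + 4 * y ^+ 2 - psi / 4) =
   t + t * b + G1 + (theta + alpha * V) * y + 4 * (t * b * b) + 4 * G2 +
   4 * (theta + alpha * V) * y ^+ 2 - (theta + alpha * V) * psi / 4.
  by rewrite /t; ring.
have tbb : t * b * b <= 9 * K%:R ^+ 2 / (1 - alpha) * w ^+ 2 * V.
  apply: (le_trans (ler_norm _)); rewrite normrM.
  have b' : `|b| <= 3 * K%:R * w / (1 - alpha) by rewrite ler_pdivlMr.
  have -> : 9 * K%:R ^+ 2 / (1 - alpha) * w ^+ 2 * V =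
    (3 * K%:R * w * V) * (3 * K%:R * w / (1 - alpha)) by ring.
  by apply: ler_pM.
have y2 : y ^+ 2 <= w ^+ 2.
  by rewrite -real_normK ?num_real// lerXn2r// nnegrE.
have uy : (theta + alpha * V) * y ^+ 2 <= (`|theta| + 1) * w ^+ 2 * V.
  have u1 : theta + alpha * V <= (`|theta| + 1) * V.
    have : theta <= `|theta| * V by have := ler_norm theta; have := normr_ge0 theta; nra.
    by move: alpha_lt1; nra.
  rewrite mulrAC; apply: ler_pM => //; exact: sqr_ge0.
have ty : theta * y <= `|theta| * w.
  apply: (le_trans (ler_norm _)); rewrite normrM; exact: ler_wpM2l.
have up : rho * psi / 2 * V <= (theta + alpha * V) * psi / 4.
  by case/andP: psi01; nra.
have : (4 * (9 * K%:R ^+ 2 / (1 - alpha) + 4 * K%:R + `|theta| + 1) + 1) * w ^+ 2 * V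
    <= rho * psi / 2 * V by rewrite ler_wpM2r//; lra.
set Q := 9 * K%:R ^+ 2 / (1 - alpha) in tbb *.
move: tbb uy G2_le; set Z := w ^+ 2 * V => tbb uy G2_le fin.
set B2 := t * b * b in tbb *; rewrite bE.
(* All bounds are rewritten in terms of Z = w^2 V, which makes the conclusion linear in the
   remaining monomials. *)
have e1 : Q * w ^+ 2 * V = Q * Z by rewrite /Z; ring.
have e2 : (`|theta| + 1) * w ^+ 2 * V = (`|theta| + 1) * Z by rewrite /Z; ring.
have e3 : 4 * K%:R * w ^+ 2 * V = 4 * (K%:R * Z) by rewrite /Z; ring.
have e4 : (4 * (Q + 4 * K%:R + `|theta| + 1) + 1) * w ^+ 2 * V =
  4 * (Q * Z) + 16 * (K%:R * Z) + 4 * ((`|theta| + 1) * Z) + Z by rewrite /Z; ring.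
rewrite e1 in tbb; rewrite e2 in uy; rewrite e3 in G2_le; rewrite e4 in fin.
lra.
Qed.

End supermartingales.

(** * The limit law and its backward flow *)

Section survival.
Context {R : realType} (alpha theta : R).
Implicit Types f : nat -> R.

(** The tail of p_alpha: the mass of the degrees larger than j, as [surv0] and [p_alphaE] show. *)
Definition surv (j : nat) : R := rising (1 - alpha) j / j`!%:R.

Lemma risingS (x : R) j : rising x j.+1 = rising x j * (x + j%:R).
Proof. by rewrite /rising big_ord_recr. Qed.

Lemma surv0 : surv 0 = 1.
Proof. by rewrite /surv /rising big_ord0 fact0 divr1. Qed.

Lemma survS j : j.+1%:R * surv j.+1 = (j.+1%:R - alpha) * surv j.
Proof.
have j0 : j.+1%:R != 0 :> R by rewrite pnatr_eq0.
have f0 : j`!%:R != 0 :> R by rewrite pnatr_eq0 -lt0n fact_gt0.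
rewrite /surv risingS factS natrM invfM -natr1.
rewrite -natr1 in j0; field.
by rewrite f0.
Qed.

Lemma p_alphaE j : p_alpha alpha j.+1 = surv j - surv j.+1.
Proof.
have j0 : j.+1%:R != 0 :> R by rewrite pnatr_eq0.
have -> : surv j.+1 = (j.+1%:R - alpha) * surv j / j.+1%:R.
  by rewrite -survS mulrC mulKf.
rewrite /p_alpha /= /surv factS natrM invfM; field.
by rewrite nat1r j0 pnatr_eq0 -lt0n fact_gt0.
Qed.

(** The p_alpha-mean of a function that is constant after K, in summed-by-parts form, which avoids
    infinite series. *)
Definition pmean (K : nat) f : R :=
  f 1%N + \sum_(0 <= j < K) surv j.+1 * (f j.+2 - f j.+1).

Lemma pmeanN K f : pmean K (fun d => - f d) = - pmean K f.
Proof.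
rewrite /pmean opprD -sumrN; congr (_ + _); apply: eq_bigr => j _; ring.
Qed.

Lemma pmeanZ K c f : pmean K (fun d => c * f d) = c * pmean K f.
Proof.
rewrite /pmean mulrDr mulr_sumr; congr (_ + _); apply: eq_bigr => j _; ring.
Qed.

(** By [survS] the sum of surv times the differences of (d - alpha)(f(d+1) - f(d)) telescopes up to
    alpha times the sum in [pmean]; the boundary term at 1 cancels because surv 1 = 1 - alpha. *)
Lemma pmean_flow K m f : m%:R + theta != 0 ->
  (forall d, (K < d)%N -> f d.+1 = f d) ->
  pmean K (flow alpha theta m f) = (1 + alpha / (m%:R + theta)) * pmean K f.
Proof.
move=> t0 fK; set t := m%:R + theta in t0 *.
suff tel : \sum_(0 <= j < K) surv j.+1 *
      ((j.+2%:R - alpha) * (f j.+3 - f j.+2) - (j.+1%:R - alpha) * (f j.+2 - f j.+1)) =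
    - ((1 - alpha) * (f 2%N - f 1%N)) +
    alpha * \sum_(0 <= j < K) surv j.+1 * (f j.+2 - f j.+1).
  rewrite /pmean /flow -/t.
  under eq_bigr => j _.
    rewrite (_ : _ * _ = surv j.+1 * (f j.+2 - f j.+1) + surv j.+1 *
      ((j.+2%:R - alpha) * (f j.+3 - f j.+2) -
       (j.+1%:R - alpha) * (f j.+2 - f j.+1)) / t); last by field.
    over.
  by rewrite big_split/= -mulr_suml tel; field.
have -> : (1 - alpha) * (f 2%N - f 1%N) = 1%:R * surv 1 * (f 2%N - f 1%N).
  by rewrite survS surv0 mulr1.
have -> : \sum_(0 <= j < K) surv j.+1 *
      ((j.+2%:R - alpha) * (f j.+3 - f j.+2) - (j.+1%:R - alpha) * (f j.+2 - f j.+1)) =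
   \sum_(0 <= j < K) (j.+2%:R * surv j.+2 * (f j.+3 - f j.+2) -
                      j.+1%:R * surv j.+1 * (f j.+2 - f j.+1)) +
   alpha * \sum_(0 <= j < K) surv j.+1 * (f j.+2 - f j.+1).
  rewrite mulr_sumr -big_split/=; apply: eq_bigr => j _.
  by rewrite (survS j.+1); ring.
congr (_ + _).
rewrite (telescope_sumr (fun j => j.+1%:R * surv j.+1 * (f j.+2 - f j.+1)))//.
by rewrite fK// subrr mulr0 sub0r.
Qed.

Lemma pmean_ge K f a : 0 <= alpha -> alpha <= 1 ->
  (forall d, (0 < d)%N -> a <= f d) -> a <= pmean K f.
Proof.
move=> a0 a1 af.
have s0 j : 0 <= surv j.
  rewrite /surv divr_ge0// /rising; apply: prodr_ge0 => i _.
  by have := ler0n R i; lra.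
have sS j : surv j.+1 <= surv j.
  have := survS j; have := s0 j; have j1 : (0 : R) < j.+1%:R by rewrite ltr0n.
  by move=> h e; rewrite -(ler_pM2l j1) e; nra.
(* Removing [surv K * f K.+1] leaves the sum over degrees at most K, of total mass 1 - surv K, which
   is suited to induction on K. *)
suff : a * (1 - surv K) <= pmean K f - surv K * f K.+1.
  by have := af K.+1 isT; have := s0 K; nra.
elim: K => [|K IH]; first by rewrite /pmean big_nil surv0; lra.
rewrite /pmean big_nat_recr//= addrA -/(pmean K f).
by have := sS K; have := af K.+1 isT; nra.
Qed.

End survival.

(** * Concentration of the degree counts at fixed length *)

Section concentration.
Context {R : realType} (alpha theta : R).
Hypotheses (alpha_gt0 : 0 < alpha) (alpha_lt1 : alpha < 1).
Hypotheses (theta_gt : - alpha < theta).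
Implicit Types (f : nat -> R) (g : seq nat -> R) (s : seq nat).

(** The window of width w is existential because the flow translates it; together with the zero mean
    the width alone bounds f. *)
Definition centred K w f :=
  [/\ forall d, (K < d)%N -> f d.+1 = f d,
      pmean alpha K f = 0 &
      exists a, forall d, (0 < d)%N -> a <= f d <= a + w].

Lemma centredN K w f : centred K w f -> centred K w (fun d => - f d).
Proof.
case=> fK f0 [a fa]; split=> [d Kd||]; first by rewrite fK.
  by rewrite pmeanN f0 oppr0.
by exists (- (a + w)) => d d0; have /andP[? ?] := fa d d0; apply/andP; split; lra.
Qed.

(** The window must contain the mean, which is 0. *)
Lemma centred_le K w f d : centred K w f -> (0 < d)%N -> `|f d| <= w.
Proof.
move=> [fK f0 [a fa]] d0.
have h1 : a <= 0.
  by rewrite -f0; apply: pmean_ge; rewrite ?ltW// => e e0; have /andP[] := fa e e0.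
have h2 : - (a + w) <= 0.
  rewrite -oppr0 -f0 -pmeanN; apply: pmean_ge; rewrite ?ltW// => e e0.
  by have /andP[? ?] := fa e e0; lra.
by have /andP[? ?] := fa d d0; rewrite ler_norml; apply/andP; split; lra.
Qed.

(** For d <= K the flow is a convex combination of f(d) and f(d+1) plus a constant: (d - alpha) / (m
    + theta) <= 1 because d + 1 <= m and theta > - alpha. Beyond K the increments are 0. *)
Lemma centred_flow K w f m : (K < m)%N -> centred K w f ->
  centred K w (flow alpha theta m f).
Proof.
move=> Km [fK f0 [a fa]].
have m1 : (1 : R) <= m%:R by rewrite ler1n; lia.
have t0 : 0 < m%:R + theta by move: theta_gt alpha_lt1; lra.
split=> [d Kd||].
- by rewrite /flow (fK d.+1 (ltnW Kd)) (fK d Kd) !subrr !mulr0.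
- by rewrite pmean_flow ?f0 ?mulr0// lt0r_neq0.
exists (a + alpha * f 1%N / (m%:R + theta)) => d d0.
have /andP[l1 u1] := fa d d0; have /andP[l2 u2] := fa d.+1 isT.
set e := alpha * _ / _; pose c := (d%:R - alpha) / (m%:R + theta).
have -> : flow alpha theta m f d = f d + c * (f d.+1 - f d) + e.
  by rewrite /flow /c /e; ring.
have [Kd|dK] := ltnP K d.
  by rewrite fK// subrr mulr0; apply/andP; split; lra.
have d1 : (1 : R) <= d%:R by rewrite ler1n.
have dm : d%:R + 1 <= m%:R :> R by rewrite natr1 ler_nat; lia.
have c0 : 0 <= c by rewrite divr_ge0 ?(ltW t0)//; move: alpha_lt1; lra.
have c1 : c <= 1 by rewrite ler_pdivrMr// mul1r; move: theta_gt; lra.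
by apply/andP; split; nra.
Qed.

(** Flows f, prescribed at length m + j, back to length m. *)
Fixpoint backflow j m f : nat -> R :=
  if j is j'.+1 then flow alpha theta m (backflow j' m.+1 f) else f.

Lemma centred_backflow K w j m f : (K < m)%N -> centred K w f ->
  centred K w (backflow j m f).
Proof.
elim: j m => [//|j IH] m Km fc /=; apply: centred_flow => //; apply: IH => //.
exact: ltnW.
Qed.

Lemma kernD g1 g2 s : kern alpha theta (fun s => g1 s + g2 s) s =
  kern alpha theta g1 s + kern alpha theta g2 s.
Proof.
by rewrite /kern -big_split/=; apply: eq_bigr => x _; rewrite mulrDr.
Qed.

Lemma kernZ c g s : kern alpha theta (fun s => c * g s) s =
  c * kern alpha theta g s.
Proof. by rewrite /kern mulr_sumr; apply: eq_bigr => x _; rewrite mulrCA. Qed.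

Lemma hwED n g1 g2 s : hwE alpha theta n (fun s => g1 s + g2 s) s =
  hwE alpha theta n g1 s + hwE alpha theta n g2 s.
Proof.
elim: n s => //= n IH s; rewrite -kernD; congr (kern _ _ _ s); exact/funext.
Qed.

Lemma hwEZ n c g s : hwE alpha theta n (fun s => c * g s) s =
  c * hwE alpha theta n g s.
Proof.
elim: n s => //= n IH s; rewrite -kernZ; congr (kern _ _ _ s); exact/funext.
Qed.

Section exponential_bound.
Variables (rho w psi : R) (K : nat).
Hypotheses (rho_gt0 : 0 < rho) (rho_le : 2 * rho <= alpha)
  (rho_le' : 2 * rho <= theta + alpha).
Hypotheses (w_gt0 : 0 < w) (psi01 : 0 <= psi <= 1).
Hypotheses (w_small : 10 * K.+1%:R * w <= 1 - alpha).
Hypotheses (psi_big : (4 * (9 * K.+1%:R ^+ 2 / (1 - alpha) + 4 * K.+1%:R +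
  `|theta| + 1) + 1) * w ^+ 2 <= rho * psi / 2).

(** When w V < |theta| the exponential is at most exp |theta| and (|theta| w - w^2 V) V is at most
    theta^2; A rho bounds their product. *)
Let A : R := expR `|theta| * theta ^+ 2 / rho.

Let A_ge0 : 0 <= A.
Proof.
apply: divr_ge0; last exact: ltW.
by apply: mulr_ge0; [exact: expR_ge0|exact: sqr_ge0].
Qed.

(* The drift theta f(1) / t is beaten by -w^2 V / t once w V >= |theta|, and
   before that by the decrease of A / V. *)
Lemma kern_exp_supermartingale f s : labelled s -> (K < size s)%N ->
  centred K w f ->
  kern alpha theta (fun s => expR (degsum f s - psi * (nlabels s)%:R) +
    A * (nlabels s)%:R^-1) s <=
  expR (degsum (flow alpha theta (size s) f) s - psi * (nlabels s)%:R) +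
    A * (nlabels s)%:R^-1.
Proof.
move=> sl Ks fc; have s0 : s != [::] by case: (s) Ks.
rewrite kernD kernZ.
have step1 : kern alpha theta (fun s => expR (degsum f s - psi * (nlabels s)%:R)) s <=
  expR (degsum (flow alpha theta (size s) f) s - psi * (nlabels s)%:R) *
  (1 + (`|theta| * w - w ^+ 2 * (nlabels s)%:R) / ((size s)%:R + theta)).
  (* [centred K] gives constancy only from degree K + 1 on, hence the shifted index. *)
  apply: (@kern_exp_step _ alpha theta rho alpha_gt0 alpha_lt1 theta_gt
    rho_gt0 rho_le rho_le' f K.+1) => //.
  - by case: fc.
  - by move=> d d0; apply: centred_le fc _.
have step2 := ler_wpM2l A_ge0 (kern_invV alpha_gt0 alpha_lt1 theta_gt rho_gt0 rho_le rho_le' sl s0).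
apply: (le_trans (lerD step1 step2)).
have V1 : (1 : R) <= (nlabels s)%:R by rewrite ler1n nlabels_gt0.
have S_le : degsum (flow alpha theta (size s) f) s <= w * (nlabels s)%:R.
  apply: degsum_le => d d0; apply: le_trans (ler_norm _) _.
  by apply: centred_le d0; exact: centred_flow fc.
have m1 : (1 : R) <= (size s)%:R by rewrite ler1n (leq_trans _ Ks).
have t0 : 0 < (size s)%:R + theta by move: theta_gt alpha_lt1; lra.
set V : R := (nlabels s)%:R in V1 S_le *; set t := _ + theta in t0 *.
set S := degsum _ _ in S_le *.
set E := expR _.
have E0 : 0 < E by exact: expR_gt0.
suff key : E * (`|theta| * w - w ^+ 2 * V) <= A * rho / V.
  rewrite -subr_ge0.
  have -> : E + A / V - (E * (1 + (`|theta| * w - w ^+ 2 * V) / t) +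
      A * ((1 - rho / t) / V)) =
     (A * rho / V - E * (`|theta| * w - w ^+ 2 * V)) / t.
    by field; rewrite !lt0r_neq0//; lra.
  by rewrite divr_ge0 ?(ltW t0)// subr_ge0.
have -> : A * rho = expR `|theta| * theta ^+ 2.
  by rewrite /A; field; exact: lt0r_neq0.
have V0 : 0 < V by lra.
have [h|h] := leP `|theta| (w * V).
  apply: (@le_trans _ _ 0).
    rewrite mulr_ge0_le0 ?(ltW E0)// expr2.
    by have := ltW w_gt0; nra.
  by rewrite divr_ge0 ?(ltW V0)// mulr_ge0 ?expR_ge0 ?sqr_ge0.
rewrite ler_pdivlMr// -mulrA ler_pM//.
- exact: ltW.
- rewrite mulr_ge0 ?(ltW V0)// expr2.
  have -> : `|theta| * w - w * w * V = w * (`|theta| - w * V) by ring.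
  by rewrite mulr_ge0 ?subr_ge0 ?ltW.
- rewrite ler_expR; case/andP: psi01 => p0 _.
  by have := mulr_ge0 p0 (ltW V0); lra.
- rewrite -(real_normK (num_real theta)) !expr2.
  have h1 : `|theta| * (w * V) <= `|theta| * `|theta| by rewrite ler_wpM2l// ltW.
  by have := sqr_ge0 (w * V); lra.
Qed.

(** The supermartingale is started only after K + 1 labels. Then V <= K + 1, which bounds its
    initial value whatever those labels are. *)
Lemma hwE_exp_bound f L : centred K w f -> (K < L)%N ->
  hwE alpha theta L (fun s => expR (degsum f s - psi * (nlabels s)%:R)) [::] <=
  expR (w * K.+1%:R) + A.
Proof.
move=> fc KL; have -> : L = (K.+1 + (L - K.+1))%N by rewrite subnKC.
set n := (L - K.+1)%N.
rewrite hwE_addn -(hwE_cst alpha_gt0 alpha_lt1 theta_gt K.+1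
  (expR (w * K.+1%:R) + A) labelled_nil).
apply: (le_hwE alpha_gt0 alpha_lt1 theta_gt labelled_nil) => s sl.
rewrite add0n => ss; have s0 : s != [::] by case: (s) ss.
have V1 : (1 : R) <= (nlabels s)%:R by rewrite ler1n nlabels_gt0.
pose G i s := expR (degsum (backflow (n - i) (K.+1 + i) f) s -
   psi * (nlabels s)%:R) + A * (nlabels s)%:R^-1.
apply: (@le_trans _ _ (hwE alpha theta n (G n) s)).
  apply: (le_hwE alpha_gt0 alpha_lt1 theta_gt sl) => s' s'l s's.
  rewrite /G subnn /= lerDl mulr_ge0// invr_ge0; exact: ler0n.
apply: (@le_trans _ _ (G 0%N s)).
  apply: (hwE_supermartingale alpha_gt0 alpha_lt1 theta_gt sl) => i s' iltn s'l s's.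
  rewrite /G (_ : (n - i)%N = (n - i.+1).+1); last by rewrite -subSn.
  have ss' : size s' = (K.+1 + i)%N by rewrite s's ss.
  rewrite /= addnS -ss'; apply: kern_exp_supermartingale => //; first by rewrite ss' leq_addr.
  by apply: centred_backflow => //; rewrite ss' leqW// leq_addr.
rewrite /G; apply: lerD; last by rewrite ler_piMr// invf_le1// (lt_le_trans ltr01).
rewrite ler_expR.
apply: (@le_trans _ _ (w * (nlabels s)%:R)).
  have : degsum (backflow (n - 0) (K.+1 + 0) f) s <= w * (nlabels s)%:R.
    apply: degsum_le => d d0; apply: le_trans (ler_norm _) _.
    by apply: centred_le d0; apply: centred_backflow fc; rewrite addn0.
  case/andP: psi01 => p0 _ h; have := mulr_ge0 p0 (le_trans ler01 V1).
  by lra.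
by rewrite ler_pM2l// ler_nat -ss nlabels_le_size.
Qed.

End exponential_bound.

Lemma centred_degree k (lam : R) : 0 < lam -> 
  centred k.+1 lam (fun d => lam * ((d == k.+1)%:R - p_alpha alpha k.+1)).
Proof.
move=> lam0; split=> [d kd||].
- by have [-> ->] : (d.+1 == k.+1 = false) /\ (d == k.+1 = false) by split; lia.
- rewrite pmeanZ /pmean.
  under eq_bigr => j _.
    rewrite (_ : _ - _ - _ = (j.+2 == k.+1)%:R - (j.+1 == k.+1)%:R); last by ring.
    over.
  rewrite p_alphaE big_nat_recr//= eqxx.
  have -> : (k.+2 == k.+1) = false by lia.
  (* Only the jumps into and out of degree k + 1 contribute; for degree 1 the jump in is the initial
     value f(1) rather than an increment. *)
  case: k => [|k].
    by rewrite big_nil surv0 eqxx /=; ring.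
  rewrite big_nat_recr//= big_nat big1; last first.
    move=> j jk; have -> : (j.+2 == k.+2) = false by lia.
    have -> : (j.+1 == k.+2) = false by lia.
    by rewrite subrr mulr0.
  have -> : (k.+1 == k.+2) = false by lia.
  by rewrite eqxx /=; ring.
- exists (- lam * p_alpha alpha k.+1) => d d0.
  by case: (d == _); rewrite /=; apply/andP; split; nra.
Qed.

Lemma Ndeg_degsum k s : (Ndeg s k)%:R = degsum (fun d => (d == k)%:R) s :> R.
Proof.
by rewrite /Ndeg /degsum -sum1_count natr_sum big_mkcond/=; apply: eq_bigr => v _;
  rewrite /occ; case: ifP.
Qed.

(** Exponential Markov inequality for the centred indicator of degree k and for its opposite, which
    covers both signs of the deviation. *)
Lemma degree_tail k (delta : R) : (0 < k)%N -> 0 < delta ->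
  exists C c : R, [/\ 0 <= C, 0 < c & forall L (x : R), (k < L)%N ->
    hwE alpha theta L (fun s => ((x <= (nlabels s)%:R) &&
      (delta * (nlabels s)%:R <
       `|(Ndeg s k)%:R - p_alpha alpha k * (nlabels s)%:R|))%:R) [::]
    <= C * expR (- (c * x))].
Proof.
case: k => // k _ delta0.
pose rho := Num.min alpha (theta + alpha) / 2.
have a1 : 0 < 1 - alpha by move: alpha_lt1; lra.
have rho0 : 0 < rho.
  by rewrite divr_gt0// lt_min alpha_gt0; move: theta_gt; lra.
have rho1 : 2 * rho <= alpha by rewrite mulrC divfK// ge_min lexx.
have rho2 : 2 * rho <= theta + alpha by rewrite mulrC divfK// ge_min lexx orbT.
pose M : R := 4 * (9 * k.+2%:R ^+ 2 / (1 - alpha) + 4 * k.+2%:R + `|theta| + 1) + 1.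
have M0 : 0 < M.
  have : 0 <= 9 * k.+2%:R ^+ 2 / (1 - alpha) by rewrite divr_ge0 ?mulr_ge0 ?sqr_ge0// ltW.
  have := normr_ge0 theta; have := ler0n R k.+2.
  by rewrite /M; lra.
(* The first bound is the smallness condition on w. The second gives psi <= lam delta / 2, so that
   half of the exponent survives the penalty; the third then gives psi <= 1. *)
pose lam := Num.min ((1 - alpha) / (10 * k.+2%:R))
  (Num.min (rho * delta / (4 * M)) delta^-1).
have lam0 : 0 < lam.
  rewrite /lam !lt_min; apply/and3P; split; last by rewrite invr_gt0.
    by rewrite divr_gt0// mulr_gt0.
  by rewrite divr_gt0// mulr_gt0.
have lam1 : lam <= (1 - alpha) / (10 * k.+2%:R) by rewrite ge_min lexx.
have lam2 : lam <= rho * delta / (4 * M) by rewrite !ge_min lexx orbT.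
have lam3 : lam <= delta^-1 by rewrite !ge_min lexx !orbT.
(* The smallest psi allowed by [psi_big]: equality holds there. *)
pose psi := 2 * M * lam ^+ 2 / rho.
have psi0 : 0 <= psi.
  by rewrite /psi divr_ge0 ?(ltW rho0)// mulr_ge0 ?sqr_ge0// mulr_ge0// ltW.
have psi1 : psi <= lam * delta / 2.
  rewrite ler_pdivlMr// in lam2; last by rewrite mulr_gt0.
  rewrite /psi ler_pdivrMr// expr2; nra.
have psi2 : psi <= 1.
  apply: (le_trans psi1).
  have : lam * delta <= 1 by rewrite -ler_pdivlMr// mul1r.
  by lra.
have small : 10 * k.+2%:R * lam <= 1 - alpha.
  by rewrite mulrC -ler_pdivlMr// mulr_gt0.
have big : M * lam ^+ 2 <= rho * psi / 2.
  rewrite /psi le_eqVlt; apply/orP; left; apply/eqP; field; exact: lt0r_neq0.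
pose p := p_alpha alpha k.+1.
pose f d := lam * ((d == k.+1)%:R - p).
have fc : centred k.+1 lam f by exact: centred_degree.
pose B := expR (lam * k.+2%:R) + expR `|theta| * theta ^+ 2 / rho.
have B0 : 0 <= B.
  by rewrite addr_ge0 ?expR_ge0// divr_ge0 ?(ltW rho0)// mulr_ge0 ?expR_ge0 ?sqr_ge0.
pose c := lam * delta / 2.
have c0 : 0 < c by rewrite divr_gt0// mulr_gt0.
exists (B + B), c; split=> //; first by rewrite addr_ge0.
move=> L x kL.
have psi01 : 0 <= psi <= 1 by rewrite psi0.
have b1 := hwE_exp_bound rho0 rho1 rho2 lam0 psi01 small big fc kL.
have b2 := hwE_exp_bound rho0 rho1 rho2 lam0 psi01 small big (centredN fc) kL.
rewrite mulrC; apply: le_trans (ler_wpM2l (expR_ge0 _) (lerD b1 b2)).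
rewrite -hwED -hwEZ.
apply: (le_hwE alpha_gt0 alpha_lt1 theta_gt labelled_nil) => s _ _.
have degf : degsum f s = lam * ((Ndeg s k.+1)%:R - p * (nlabels s)%:R).
  rewrite Ndeg_degsum /f /degsum -mulr_sumr sumrB; congr (_ * (_ - _)).
  by rewrite big_const_seq count_predT iter_addr_0 mulr_natr.
have degfN : degsum (fun d => - f d) s = - degsum f s by rewrite /degsum sumrN.
have E0 z : 0 <= expR z :> R by exact: expR_ge0.
case: (boolP (_ && _)) => [/andP[xV dV]|_]; last first.
  by rewrite mulr_ge0 ?addr_ge0.
set V : R := (nlabels s)%:R in xV dV *; set D := (Ndeg _ _)%:R - _ in dV degf.
(* On the event, lam |D| - psi V >= (lam delta - psi) V >= c V >= c x. *)
have main : 1 <= expR (- (c * x)) * expR (lam * `|D| - psi * V).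
  rewrite -expRD -[leLHS](expR0 R) ler_expR.
  have V0 : 0 <= V by exact: ler0n.
  have : lam * (delta * V) <= lam * `|D| by rewrite ler_pM2l// ltW.
  have : psi * V <= c * V by rewrite ler_wpM2r.
  have : c * x <= c * V by rewrite ler_pM2l.
  by rewrite /c; nra.
apply: (le_trans main); rewrite ler_wpM2l// degfN degf.
have [D0|D0] := leP 0 D; first by rewrite (ger0_norm D0) lerDl.
by rewrite (ltr0_norm D0) mulrN lerDr.
Qed.

End concentration.

(** * Law of the edge process *)

Section path_expansion.
Context {R : realType} (alpha theta : R).
Implicit Types (s z : seq nat) (g : seq nat -> R).

(** A finite list containing every continuation of positive probability; it turns [hwE] into a sum
    over label lists, comparable with the joint law in [hollywood]. *)
Fixpoint extensions L s : seq (seq nat) :=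
  if L is L'.+1 then
    [seq x :: z | x <- index_iota 1 (nlabels s).+2, z <- extensions L' (rcons s x)]
  else [:: [::]].

Lemma extensionsS L s : extensions L.+1 s =
  [seq x :: z | x <- index_iota 1 (nlabels s).+2, z <- extensions L (rcons s x)].
Proof. by []. Qed.

Lemma hwE_extensions L g s : hwE alpha theta L g s =
  \sum_(z <- extensions L s) hw_seq_aux alpha theta s z * g (s ++ z).
Proof.
elim: L s => [|L IH] s; first by rewrite big_seq1 /= mul1r cats0.
rewrite extensionsS big_allpairs_dep [LHS]/= /kern; apply: eq_bigr => x _.
rewrite IH mulr_sumr; apply: eq_bigr => z _ /=.
by rewrite mulrA cat_rcons.
Qed.

Lemma extensions_uniq L s : uniq (extensions L s).
Proof.
elim: L s => [//|L IH] s; rewrite extensionsS.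
apply: allpairs_uniq_dep; rewrite ?iota_uniq//.
by move=> [x1 z1] [x2 z2] _ _ /= [-> ->].
Qed.

Lemma size_extensions L s z : z \in extensions L s -> size z = L.
Proof.
elim: L s z => [|L IH] s z; first by rewrite inE => /eqP->.
rewrite extensionsS; by case/allpairsPdep => x [z' [_ /IH<- ->]].
Qed.

Lemma hw_seq_aux_out s z : z \notin extensions (size z) s ->
  hw_seq_aux alpha theta s z = 0.
Proof.
elim: z s => [|x z IH] s; first by rewrite inE.
rewrite [size _]/= extensionsS => zs; rewrite [LHS]/=.
have [xV|xV] := boolP (x \in index_iota 1 (nlabels s).+2).
  rewrite IH ?mulr0//; apply: contra zs => zs.
  by apply/allpairsPdep; exists x, z.
suff -> : hw_step alpha theta s x = 0 by rewrite mul0r.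
rewrite mem_index_iota in xV; rewrite /hw_step; case: s xV {zs} => [|y s] xV.
  by have -> : (x == 1%N) = false by move: xV; rewrite /nlabels /=; lia.
by rewrite !ifF//; move: xV; clear; lia.
Qed.

End path_expansion.

(** * Conditioning on a discrete random variable *)

Section countable_partition.
Context {R : realType} {d : measure_display} {T : measurableType d}.
Context (P : probability T R) {C : countType} (Z : T -> C).
Hypothesis mZ : forall c, measurable (Z @^-1` [set c]).

Let F k := [set w | pickle (Z w) = k].

Let mF k : measurable (F k).
Proof.
have [[c ck]|nok] := pselect (exists c : C, pickle c = k :> nat).
  rewrite (_ : F k = Z @^-1` [set c]) //; apply/seteqP; split => w /=.
    by rewrite /F/= -ck => /(pcan_inj (@pickleK C)).
  by rewrite /F/= => ->.
rewrite (_ : F k = set0)//; apply/seteqP; split => w //= Fk.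
by apply: nok; exists (Z w).
Qed.

Let bigcupF (B : set T) : B = \bigcup_k (B `&` F k).
Proof.
apply/seteqP; split => w /=; last by case=> k _ [].
by move=> Bw; exists (pickle (Z w)).
Qed.

Lemma measurable_countable_preimage (Q : set C) : measurable (Z @^-1` Q).
Proof.
rewrite [X in measurable X]bigcupF; apply: bigcupT_measurable => k.
have [[c [ck Qc]]|nok] := pselect (exists c : C, pickle c = k :> nat /\ Q c).
  rewrite (_ : _ `&` _ = F k)//; apply/seteqP; split => w /=; first by case.
  by rewrite /F/= => h; split => //; move: h; rewrite -ck => /(pcan_inj (@pickleK C)) ->.
rewrite (_ : _ `&` _ = set0)//; apply/seteqP; split => w //= [Qw Fk].
by apply: nok; exists (Z w).
Qed.

(** Law of total probability: subadditivity over the fibres of Z, indexed by their codes, whose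
    probabilities sum to 1. The product form avoids conditioning on null fibres. *)
Lemma le_measure_partition (B : set T) (e : R) : measurable B -> 0 <= e ->
  (forall c, P (B `&` Z @^-1` [set c]) <= e%:E * P (Z @^-1` [set c]))%E ->
  (P B <= e%:E)%E.
Proof.
move=> mB e0 Bc.
have sub : (P B <= \sum_(0 <= k <oo) P (B `&` F k))%E.
  apply: measure_sigma_subadditive => //; first by move=> k; exact: measurableI.
  by rewrite -bigcupF.
apply: (le_trans sub).
apply: (@le_trans _ _ (\sum_(0 <= k <oo) (e%:E * P (F k)))%E).
  apply: lee_nneseries => [k *|k _]; first exact: measure_ge0.
  have [[c ck]|nok] := pselect (exists c : C, pickle c = k :> nat).
    have FE : F k = Z @^-1` [set c].
      apply/seteqP; split => w /=; last by rewrite /F/= => ->.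
      by rewrite /F/= -ck => /(pcan_inj (@pickleK C)).
    by rewrite FE.
  have FE : F k = set0.
    by apply/seteqP; split => w //= Fk; apply: nok; exists (Z w).
  by rewrite FE setI0 !measure0 mule0.
rewrite nneseriesZl//.
have -> : (\sum_(0 <= k <oo) P (F k) = 1)%E.
  rewrite -[RHS](@probability_setT _ _ _ P) [in RHS](bigcupF setT).
  under eq_eseriesr => k _ do rewrite -[F k]setTI.
  apply/esym; apply: measure_semi_bigcup => //.
  - by move=> k; exact: measurableI.
  - by move=> i j _ _ [w [[_ <-] [_ <-]]].
  - by rewrite -bigcupF.
by rewrite mule1.
Qed.

End countable_partition.

Section edge_process.
Context {R : realType} {d : measure_display} {T : measurableType d}.
Context (P : probability T R) (alpha theta : R) (nu : nat -> R).
Context (X : nat -> T -> seq nat).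
Hypotheses (alpha_gt0 : 0 < alpha) (alpha_lt1 : alpha < 1).
Hypotheses (theta_gt : - alpha < theta).
Hypotheses (nuP : prob_on_pos nu) (XP : hollywood P alpha theta nu X).

Definition edges n w : seq (seq nat) := [seq X i w | i <- iota 0 n].

Lemma size_edges n w : size (edges n w) = n.
Proof. by rewrite size_map size_iota. Qed.

Lemma edges_fiber xs : edges (size xs) @^-1` [set xs] =
  [set w | forall i, (i < size xs)%N -> X i w = nth [::] xs i].
Proof.
apply/seteqP; split => w /=.
  by move=> <- i; rewrite size_edges => iln; rewrite (nth_map 0%N) ?size_iota ?nth_iota.
move=> h; apply: (@eq_from_nth _ [::]); rewrite size_edges// => i iln.
by rewrite -h// (nth_map 0%N) ?size_iota ?nth_iota.
Qed.

Lemma measurable_edges n xs : measurable (edges n @^-1` [set xs]).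
Proof.
have [<-|/eqP nxs] := eqVneq (size xs) n; last first.
  rewrite (_ : _ @^-1` _ = set0)//; apply/seteqP; split => w //= e.
  by apply: nxs; rewrite -e size_edges.
rewrite edges_fiber.
rewrite (_ : [set w | _] = \bigcap_(i in [set i | (i < size xs)%N])
    (X i @^-1` [set nth [::] xs i])); last by apply/seteqP; split.
by apply: bigcap_measurableType => i _; case: XP.
Qed.

Lemma measurable_edges_preimage n (Q : set (seq (seq nat))) :
  measurable (edges n @^-1` Q).
Proof. by apply: measurable_countable_preimage => xs; exact: measurable_edges. Qed.

(** [reshape ks] is a bijection from label lists of length [sumn ks] to edge lists of shape [ks], so
    given the sizes the concatenated labels follow the sequential rule. *)
Lemma edges_law (ks : seq nat) (A : pred (seq nat)) :
  P (edges (size ks) @^-1` [set xs | shape xs = ks /\ A (flatten xs)]) =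
  ((\prod_(k <- ks) nu k) *
   hwE alpha theta (sumn ks) (fun s => (A s)%:R) [::])%:E.
Proof.
set Q := [set xs | _]; set n := size ks; set E := extensions (sumn ks) [::].
have fiber xs : shape xs = ks -> P (edges n @^-1` [set xs]) =
    ((\prod_(k <- ks) nu k) * hw_seq_prob alpha theta (flatten xs))%:E.
  move=> sxs; have -> : n = size xs by rewrite /n -sxs size_map.
  by rewrite edges_fiber; case: XP => _ ->; rewrite -sxs big_map.
(* The edge lists off the finite support: infinitely many, each null, hence jointly null by
   [le_measure_partition] with bound 0. *)
pose Q' := Q `&` [set xs | flatten xs \notin E].
have PQ' : P (edges n @^-1` Q') = 0%E.
  apply/eqP; rewrite eq_le measure_ge0 andbT.
  apply: (le_measure_partition (Z := edges n)) => //.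
  - exact: measurable_edges.
  - exact: measurable_edges_preimage.
  move=> xs; rewrite mul0e.
  have [Qxs|nQxs] := pselect (Q' xs); last first.
    rewrite (_ : _ `&` _ = set0) ?measure0//; apply/seteqP; split => w //=.
    by case=> Qw e; apply: nQxs; rewrite -e.
  apply: (@le_trans _ _ (P (edges n @^-1` [set xs]))).
    apply: le_measure; rewrite ?inE.
    - by apply: measurableI; [exact: measurable_edges_preimage|exact: measurable_edges].
    - exact: measurable_edges.
    - by move=> w [].
  case: Qxs => -[/= sxs _] fxs; rewrite fiber// /hw_seq_prob hw_seq_aux_out ?mulr0//.
  by rewrite size_flatten sxs.
have QE : edges n @^-1` Q =
    (\bigcup_(z in [set` [seq z <- E | A z]]) (edges n @^-1` [set reshape ks z]))
    `|` edges n @^-1` Q'.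
  apply/seteqP; split => w /=.
    move=> [sw Aw]; have [fE|fE] := boolP (flatten (edges n w) \in E).
      left; exists (flatten (edges n w)); first by rewrite /= mem_filter Aw.
      by rewrite /= -{1}(flattenK (edges n w)) sw.
    by right.
  case=> [[z]|[]//]; rewrite /= mem_filter => /andP[Az zE] ->.
  have sz := size_extensions zE.
  by split; [rewrite reshapeKl ?sz|rewrite reshapeKr ?sz].
have mU : measurable (\bigcup_(z in [set` [seq z <- E | A z]])
    (edges n @^-1` [set reshape ks z])).
  apply: fin_bigcup_measurable; first exact: finite_seq.
  by move=> z _; exact: measurable_edges.
rewrite QE measureU//; last 2 first.
- exact: measurable_edges_preimage.
- apply/seteqP; split => w //= -[[z]]; rewrite /= mem_filter => /andP[Az zE] ->.
  have sz := size_extensions zE.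
  by case=> _ /=; rewrite reshapeKr ?sz// zE.
rewrite [X in (_ + X)%E]PQ' adde0 measure_fin_bigcup//; last 3 first.
- exact: finite_seq.
- move=> z1 z2; rewrite /= !mem_filter => /andP[_ z1E] /andP[_ z2E] [w [/= e1 e2]].
  rewrite -(@reshapeKr _ ks z1) ?(size_extensions z1E)//.
  by rewrite -(@reshapeKr _ ks z2) ?(size_extensions z2E)// -e1 -e2.
- by move=> z _; exact: measurable_edges.
rewrite -fsbig_seq ?filter_uniq ?extensions_uniq// hwE_extensions mulr_sumr.
rewrite big_filter big_mkcond -sumEFin big_seq [RHS]big_seq.
apply: eq_bigr => z zE; have sz := size_extensions zE.
case: ifPn => Az; last by rewrite !mulr0.
by rewrite [LHS]fiber ?reshapeKl ?reshapeKr ?sz// mulr1.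
Qed.

Lemma le_edges_prob n (A : pred (seq nat)) (e : R) : 0 <= e ->
  (forall L, (n <= L)%N -> hwE alpha theta L (fun s => (A s)%:R) [::] <= e) ->
  (P [set w | A (appearances (fun i => X i w) n)] <= e%:E)%E.
Proof.
move=> e0 Ae.
have -> : [set w | A (appearances (fun i => X i w) n)] =
  edges n @^-1` [set xs | A (flatten xs)] by [].
pose Z w := shape (edges n w).
apply: (le_measure_partition (Z := Z)) => //.
- by move=> ks; exact: (measurable_edges_preimage n [set xs | shape xs = ks]).
- exact: measurable_edges_preimage.
move=> ks; have [nks|/eqP nks] := eqVneq (size ks) n; last first.
  rewrite (_ : Z @^-1` _ = set0) ?setI0 ?measure0 ?mule0//.
  apply/seteqP; split => w //= e'; apply: nks.
  by rewrite -e' /Z size_map size_edges.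
have -> : edges n @^-1` [set xs | A (flatten xs)] `&` Z @^-1` [set ks] =
    edges (size ks) @^-1` [set xs | shape xs = ks /\ A (flatten xs)].
  by rewrite nks; apply/seteqP; split => w /= [].
(* With the trivial predicate [edges_law] also gives the probability of the shape itself. *)
have -> : Z @^-1` [set ks] =
    edges (size ks) @^-1` [set xs | shape xs = ks /\ predT (flatten xs)].
  by rewrite nks; apply/seteqP; split => w /=; [split|case].
rewrite !edges_law -EFinM lee_fin [X in _ <= _ * (_ * X)]hwE_cst//; last first.
  exact: labelled_nil.
rewrite mulr1 [e * _]mulrC.
case: nuP => nu0 [nu_ge0 _].
(* Shapes with an empty edge have probability 0; in all others the length [sumn ks] is at least
   n. *)
have [k0|kpos] := boolP (0%N \in ks).
  by rewrite (perm_big _ (perm_to_rem k0)) /= big_cons nu0 !mul0r.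
apply: ler_wpM2l; first by apply: prodr_ge0.
apply: Ae; rewrite -nks; elim: ks kpos {nks} => //= k ks IH.
rewrite inE negb_or => /andP[k0 /IH]; lia.
Qed.

End edge_process.

(** * Almost sure convergence *)

(** Markov's inequality for 1 / V: the indicator of V < x is at most x / V. *)
Lemma nlabels_tail {R : realType} (alpha theta : R) :
  0 < alpha -> alpha < 1 -> - alpha < theta ->
  exists2 r : R, 0 < r & forall L (x : R), (0 < L)%N -> 0 <= x ->
    hwE alpha theta L (fun s => ((nlabels s)%:R < x)%R%:R) [::] <= x / L%:R `^ r.
Proof.
move=> a0 a1 ta.
pose rho := Num.min alpha (theta + alpha) / 2.
have rho0 : 0 < rho by rewrite divr_gt0// lt_min a0; lra.
have rho1 : 2 * rho <= alpha by rewrite mulrC divfK// ge_min lexx.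
have rho2 : 2 * rho <= theta + alpha by rewrite mulrC divfK// ge_min lexx orbT.
have t0 : 0 < 1 + `|theta| by rewrite ltr_pwDl.
exists (rho / (1 + `|theta|)); first exact: divr_gt0.
set r := rho / _; have r0 : 0 < r by exact: divr_gt0.
case=> // L x _ x0.
have r_le : r * (1 + `|theta|) <= rho by rewrite divfK// lt0r_neq0.
have := hwE_invV a0 a1 ta rho0 rho1 rho2 L r0 r_le.
set Lr := _ `^ _; have Lr0 : 0 < Lr by rewrite powR_gt0.
move=> h.
rewrite -[leRHS]mulr1; apply: le_trans (ler_wpM2l _ h); last first.
  by rewrite divr_ge0// ltW.
rewrite -hwEZ; apply: (le_hwE a0 a1 ta labelled_nil) => s _ ss.
have V0 : (0 : R) < (nlabels s)%:R by rewrite ltr0n nlabels_gt0//; case: (s) ss.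
rewrite mulrA divfK ?lt0r_neq0//; case: ltP => Vx /=.
  by rewrite ler_pdivlMr// mul1r ltW.
by rewrite divr_ge0// ltW.
Qed.

Section borel_cantelli_bound.
Context {R : realType} {d : measure_display} {T : measurableType d}.
Context (P : probability T R).

Lemma ae_eventually_not (F : nat -> set T) (u : nat -> R) (M : R) :
  (forall n, measurable (F n)) -> (forall n, (P (F n) <= (u n)%:E)%E) ->
  (forall n, \sum_(0 <= i < n) u i <= M) ->
  {ae P, forall w, exists N, forall n, (N <= n)%N -> ~ F n w}.
Proof.
move=> mF Fu uM; exists (lim_sup_set F); split.
- by apply: bigcap_measurableType => n _; apply: bigcup_measurable.
- apply: lim_sup_set_cvg0 => //; apply: (@le_lt_trans _ _ M%:E); last exact: ltry.
  apply: lime_le; first exact: is_cvg_nneseries.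
  apply: nearW => n; apply: (@le_trans _ _ (\sum_(0 <= i < n) (u i)%:E)%E).
    by apply: lee_sum => i _; exact: Fu.
  by rewrite sumEFin lee_fin.
move=> w /= nw n _; apply: contrapT => h; apply: nw; exists n => m nm Fm.
by apply: h; exists m.
Qed.

End borel_cantelli_bound.

Lemma sum_inv_consecutive {R : realType} n :
  \sum_(0 <= i < n) (i%:R * i.+1%:R)^-1 <= 1 :> R.
Proof.
have inv_consecutive (y : R) : y != 0 -> y + 1 != 0 ->
    (y * (y + 1))^-1 = - (y + 1)^-1 - (- y^-1).
  by move=> y0 y1; field; rewrite y0.
case: n => [|n]; first by rewrite big_nil.
(* The term at 0 is the inverse of 0, which is 0 by convention. *)
rewrite big_nat_recl// mul0r invr0 add0r.
under eq_bigr => i _.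
  rewrite (_ : _^-1 = (- i.+2%:R^-1) - (- i.+1%:R^-1) :> R); last first.
    by rewrite -(natr1 i.+1) inv_consecutive// ?natr1 pnatr_eq0.
  over.
rewrite (telescope_sumr (fun i => - i.+1%:R^-1 : R))// invr1 opprK.
by rewrite addrC gerBl invr_ge0.
Qed.

Lemma nvert_appearances (Y : nat -> seq nat) m n : (m <= n)%N ->
  (nvert (appearances Y m) <= nvert (appearances Y n))%N.
Proof.
move=> mn; apply: uniq_leq_size; first exact: undup_uniq.
move=> v; rewrite !mem_undup /appearances -(subnKC mn) iotaD map_cat flatten_cat.
by rewrite mem_cat => ->.
Qed.

Section almost_sure.
Context {R : realType} {d : measure_display} {T : measurableType d}.
Context (P : probability T R) (alpha theta : R) (nu : nat -> R).
Context (X : nat -> T -> seq nat).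
Hypotheses (alpha_gt0 : 0 < alpha) (alpha_lt1 : alpha < 1).
Hypotheses (theta_gt : - alpha < theta).
Hypotheses (nuP : prob_on_pos nu) (XP : hollywood P alpha theta nu X).

Let app n w := appearances (fun i => X i w) n.

Let measurable_app n (A : pred (seq nat)) : measurable [set w | A (app n w)].
Proof.
exact: (measurable_edges_preimage XP n [set xs | A (flatten xs)]).
Qed.

(* The exponent 2 / (p + 1) makes the (p + 1)-st power of the threshold a
   square, so that the bound of degree_tail is summable. *)
Lemma nvert_growth : exists p : nat, {ae P, forall w, exists N, forall n,
  (N <= n)%N -> (n%:R / 2) `^ (2 / p.+1%:R) <= (nvert (app n w))%:R :> R}.
Proof.
have [r r0 tail] := nlabels_tail alpha_gt0 alpha_lt1 theta_gt.
(* Ensures 2 b <= r: at N = 2^j the tail bound N^(b - r) is then at most N^(-b), which is geometric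
   in j. *)
pose p := Num.bound (4 / r); exists p; set b := 2 / p.+1%:R.
have b0 : 0 < b by rewrite divr_gt0.
have br : b + b <= r.
  have : 4 / r < p.+1%:R.
    apply: (lt_le_trans (archi_boundP _)); last by rewrite ler_nat.
    by rewrite divr_ge0// ltW.
  rewrite ltr_pdivrMr// => h.
  have -> : b + b = 4 / p.+1%:R by rewrite /b; field; rewrite nat1r pnatr_eq0.
  by rewrite ler_pdivrMr ?ltr0n// mulrC ltW.
pose z : R := 2 `^ (- b).
have z0 : 0 < z by rewrite powR_gt0.
have z1 : `|z| < 1.
  rewrite gtr0_norm// /z /powR ifF ?pnatr_eq0// expR_lt1 mulNr oppr_lt0.
  by rewrite mulr_gt0// ln_gt0// ltr1n.
have : {ae P, forall w, exists N, forall j, (N <= j)%N ->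
    ~ [set w | ((nlabels (app (2 ^ j) w))%:R < (2 ^ j)%:R `^ b :> R)] w}.
  apply: (@ae_eventually_not _ _ _ _ _ (fun j => z ^+ j) (1 / (1 - z))).
  - move=> j; exact: (measurable_app (2 ^ j) (fun s => (nlabels s)%:R < (2 ^ j)%:R `^ b)).
  - move=> j.
    apply: (le_edges_prob alpha_gt0 alpha_lt1 theta_gt nuP XP
      (A := fun s => (nlabels s)%:R < (2 ^ j)%:R `^ b)); first by rewrite exprn_ge0// ltW.
    move=> L jL.
    have N1 : (1 : R) <= (2 ^ j)%:R by rewrite ler1n expn_gt0.
    have N0 : (0 : R) < (2 ^ j)%:R by apply: lt_le_trans N1.
    have NL : (2 ^ j)%:R <= L%:R :> R by rewrite ler_nat.
    have L0 : (0 < L)%N by apply: leq_trans jL; rewrite expn_gt0.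
    apply: (le_trans (tail L _ L0 (powR_ge0 _ _))).
    have -> : z ^+ j = (2 ^ j)%:R `^ (- b).
      by rewrite natrX -(@powR_mulrn _ 2 j)// -powRrM mulrC powRrM powR_mulrn// powR_ge0.
    rewrite ler_pdivrMr ?powR_gt0 ?ltr0n//.
    apply: (@le_trans _ _ ((2 ^ j)%:R `^ (- b) * (2 ^ j)%:R `^ (b + b))).
      by rewrite -powRD ?lt0r_neq0 ?implybT// addrA addNr add0r.
    rewrite ler_wpM2l ?powR_ge0//.
    apply: (@le_trans _ _ ((2 ^ j)%:R `^ r)); first exact: ler_powR.
    by apply: ge0_ler_powR; rewrite ?nnegrE ?ler0n// ltW.
  - move=> n; apply: le_trans (geometric_le_lim n ler01 z0 z1).
    by rewrite /series/=; apply: ler_sum => i _; rewrite mul1r.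
apply: filterS => w [N hN]; exists (2 ^ N)%N => n Nn.
have n0 : (0 < n)%N by apply: leq_trans Nn; rewrite expn_gt0.
(* Interpolation between powers of 2: n / 2 < 2^j <= n, which is the origin of the factor 1/2. *)
have /andP[] := trunc_log_bounds (isT : (1 < 2)%N) n0.
set j := trunc_log 2 n => jn nj.
have Nj : (N <= j)%N by apply: trunc_log_max.
have := hN j Nj; rewrite /= => /negP; rewrite -leNgt => h.
apply: (@le_trans _ _ ((2 ^ j)%:R `^ b)).
  apply: ge0_ler_powR; rewrite ?nnegrE ?ler0n ?divr_ge0//.
  by rewrite ltW// ltr_pdivrMr// -natrM -expnSr ltr_nat.
by apply: (le_trans h); rewrite ler_nat; exact: nvert_appearances.
Qed.

Lemma degree_deviation k (delta : R) : (0 < k)%N -> 0 < delta ->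
  {ae P, forall w, exists N, forall n, (N <= n)%N ->
    (0 < nvert (app n w))%N /\
    `|(Ndeg (app n w) k)%:R - p_alpha alpha k * (nvert (app n w))%:R| <=
      delta * (nvert (app n w))%:R}.
Proof.
move=> k0 delta0; have [p growth] := nvert_growth; set b := 2 / p.+1%:R in growth.
have [C [c [C0 c0 tail]]] := degree_tail alpha_gt0 alpha_lt1 theta_gt k0 delta0.
pose x n : R := (n%:R / 2) `^ b.
pose A n : pred (seq nat) := fun s => (k < n)%N && ((x n <= (nlabels s)%:R) &&
      (delta * (nlabels s)%:R <
       `|(Ndeg s k)%:R - p_alpha alpha k * (nlabels s)%:R|)).
(* exp(- c x) <= (p+1)! / (c x)^(p+1) with x^(p+1) = (n / 2)^2, and (n / 2)^2 >= n (n + 1) / 8 for n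
   >= 1. *)
pose D := C * (8 * (p.+1)`!%:R / c ^+ p.+1).
have D0 : 0 <= D by rewrite !mulr_ge0// invr_ge0 exprn_ge0// ltW.
have : {ae P, forall w, exists N, forall n, (N <= n)%N -> ~ [set w | A n (app n w)] w}.
  apply: (@ae_eventually_not _ _ _ _ _ (fun n => D * (n%:R * n.+1%:R)^-1) D).
  - by move=> n; exact: (measurable_app n (A n)).
  - move=> n; apply: (le_edges_prob alpha_gt0 alpha_lt1 theta_gt nuP XP).
      by rewrite mulr_ge0// invr_ge0 mulr_ge0.
    move=> L nL; rewrite /A; have [kn|kn] := ltnP k n; last first.
      rewrite /= hwE_cst//; last exact: labelled_nil.
      by rewrite mulr_ge0// invr_ge0 mulr_ge0.
    apply: (le_trans (tail L (x n) (leq_trans kn nL))).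
    rewrite /D -mulrA ler_wpM2l//.
    have n1 : (1 : R) <= n%:R by rewrite ler1n; apply: leq_trans kn.
    have n0 : (0 : R) < n%:R by apply: lt_le_trans n1.
    have xp : (c * x n) ^+ p.+1 = c ^+ p.+1 * (n%:R / 2) ^+ 2.
      rewrite exprMn -[x n ^+ _]powR_mulrn ?powR_ge0// /x -powRrM /b divfK.
        by rewrite powR_mulrn// divr_ge0// ltW.
      by rewrite pnatr_eq0.
    have y0 : 0 <= c * x n by rewrite mulr_ge0 ?powR_ge0// ltW.
    have := expR_ge1Dxn p y0; rewrite xp => h.
    rewrite expRN -[leRHS]invrK lef_pV2 ?posrE ?expR_gt0//; last first.
      rewrite invr_gt0; apply: divr_gt0; last by apply: mulr_gt0.
      by apply: divr_gt0; [apply: mulr_gt0 => //; rewrite ltr0n fact_gt0|exact: exprn_gt0].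
    apply: le_trans h; rewrite -[leLHS]add0r; apply: lerD => //.
    set f : R := (p.+1)`!%:R; have f0 : 0 < f by rewrite ltr0n fact_gt0.
    have cp0 : 0 < c ^+ p.+1 by rewrite exprn_gt0.
    rewrite -(natr1 n).
    have -> : (8 * f / c ^+ p.+1 / (n%:R * (n%:R + 1)))^-1 =
       c ^+ p.+1 / f * (n%:R * (n%:R + 1) / 8).
      by field; rewrite !lt0r_neq0// ltr_pwDr.
    have -> : c ^+ p.+1 * (n%:R / 2) ^+ 2 / f = c ^+ p.+1 / f * ((n%:R / 2) ^+ 2).
      by rewrite mulrAC.
    rewrite ler_wpM2l//; first by rewrite divr_ge0// ltW.
    by rewrite expr2; nra.
  - move=> n; rewrite -mulr_sumr -[leRHS]mulr1 ler_wpM2l//.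
    exact: sum_inv_consecutive.
move=> dev; apply: filterS2 growth dev => w [N1 h1] [N2 h2].
exists (maxn k.+1 (maxn N1 N2)) => n; rewrite !geq_max => /andP[kn /andP[n1 n2]].
have xV := h1 n n1; have := h2 n n2; rewrite /= /A kn xV/= => /negP.
rewrite -leNgt => h; split => //.
rewrite -(ltr0n R); apply: lt_le_trans xV; apply: powR_gt0.
by rewrite divr_gt0// ltr0n; apply: leq_trans kn.
Qed.

Lemma emp_deg_cvg k : (0 < k)%N ->
  {ae P, forall w, (fun n : nat => emp_deg (fun i => X i w) n.+1 k : R) @ \oo
                        --> p_alpha alpha k}.
Proof.
move=> k0.
(* Countably many tolerances 1 / (i + 1) suffice, and a countable intersection keeps full
   measure. *)
have : \forall w \ae P, forall i, exists N, forall n, (N <= n)%N ->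
    (0 < nvert (app n w))%N /\
    `|(Ndeg (app n w) k)%:R - p_alpha alpha k * (nvert (app n w))%:R| <=
      i.+1%:R^-1 * (nvert (app n w))%:R.
  by apply: ae_foralln => i; apply: degree_deviation => //; rewrite invr_gt0.
apply: filterS => w h; apply/cvgrPdist_le => e e0.
have [N hN] := h (Num.bound e^-1).
near=> n; have nN : (N <= n.+1)%N by apply: leqW; near: n; exact: nbhs_infty_ge.
have [V0 dev] := hN n.+1 nN.
have Vgt : (0 : R) < (nvert (app n.+1 w))%:R by rewrite ltr0n.
rewrite distrC /emp_deg -(ler_pM2r Vgt) -{2}(gtr0_norm Vgt) -normrM mulrBl.
rewrite divfK ?lt0r_neq0//; apply: (le_trans dev); rewrite ler_pM2r//.
rewrite invf_ple ?posrE//; apply: ltW.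
apply: (lt_le_trans (archi_boundP _)); last by rewrite ler_nat.
by rewrite invr_ge0 ltW.
Unshelve. all: by end_near.
Qed.

End almost_sure.

(** * The Gamma function and the power law *)

Section gamma_integral.
Context {R : realType}.
Notation mu := (@lebesgue_measure R).

(** Gamma before [fine]: the functional equation and Wendel's inequality hold in the extended reals,
    and finiteness at 1 - alpha is deduced from them. *)
Definition gammaI (s : R) : \bar R :=
  (\int[mu]_(x in `]0%R, +oo[) ((x `^ (s - 1)) * expR (- x))%:E)%E.

Lemma measurable_gamma_integrand (s : R) (D : set R) :
  measurable_fun D (EFin \o (fun x : R => (x `^ (s - 1)) * expR (- x))).
Proof.
apply/measurable_EFinP; apply: measurable_funM.
  by apply: measurable_funTS; exact: measurable_powR.
by apply: measurable_funTS; apply: measurableT_comp.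
Qed.

Lemma gamma_integrand_ge0 (s x : R) : (0 <= ((x `^ (s - 1)) * expR (- x))%:E)%E.
Proof. by rewrite lee_fin mulr_ge0 ?powR_ge0 ?expR_ge0. Qed.

Lemma gammaI_ge0 s : (0 <= gammaI s)%E.
Proof. by apply: integral_ge0 => x _; exact: gamma_integrand_ge0. Qed.

(** Young's inequality for the product y^t 1 with exponents 1 / t and 1 / (1 - t) is the case c = 1;
    the rest is scaling by c. *)
Lemma powR_le_tangent (c t x : R) : 0 < c -> 0 < t < 1 -> 0 < x ->
  x `^ t <= (1 - t) * c `^ t + t * c `^ (t - 1) * x.
Proof.
move=> c0 /andP[t0 t1] x0; have t1' : 0 < 1 - t by lra.
have xE : x = c * (x / c) by rewrite mulrC divfK// lt0r_neq0.
set y := x / c in xE; have y0 : 0 < y by rewrite divr_gt0.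
have young : y `^ t <= 1 - t + t * y.
  have := @conjugate_powR R (y `^ t) 1 t^-1 (1 - t)^-1 (powR_ge0 _ _) ler01.
  have -> : (y `^ t) `^ t^-1 = y.
    by rewrite -powRrM divff ?lt0r_neq0// powRr1// ltW.
  by rewrite !invr_gt0 !invrK powR1 => /(_ t0 t1' (subrKC _ _)); lra.
rewrite xE powRM ?(ltW c0) ?(ltW y0)// powRB ?(lt0r_neq0 c0) ?implybT//.
rewrite (powRr1 (ltW c0)).
have -> : (1 - t) * c `^ t + t * (c `^ t / c) * (c * y) = c `^ t * (1 - t + t * y).
  by field; exact: lt0r_neq0.
by rewrite ler_pM2l// powR_gt0.
Qed.

Lemma derivable_LRcontinuous (F f : R -> R) (a b : R) : a < b ->
  (forall x, a <= x <= b -> is_derive x 1 F (f x)) ->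
  derivable_oo_LRcontinuous F a b.
Proof.
move=> ab dF.
have cF x : a <= x <= b -> {for x, continuous F}.
  move=> xab; apply/differentiable_continuous/derivable1_diffP.
  by have := dF x xab; case.
split.
- move=> x; rewrite in_itv/= => /andP[ax xb].
  by have := dF x; rewrite !ltW// => /(_ isT); case.
- by apply: cvg_at_right_filter; apply: cF; rewrite lexx ltW.
- by apply: cvg_at_left_filter; apply: cF; rewrite lexx ltW.
Qed.

Lemma within_continuous_derive (F f : R -> R) (a b : R) :
  (forall x, a <= x <= b -> is_derive x 1 F (f x)) ->
  {within `[a, b], continuous F}.
Proof.
move=> dF; apply: continuous_in_subspaceT => x; rewrite inE/= in_itv/= => xab.
apply/differentiable_continuous/derivable1_diffP.
by have := dF x xab; case.
Qed.

Lemma is_derive_expRN (x : R) : is_derive x 1 (fun x => - expR (- x)) (expR (- x)).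
Proof.
by apply: is_derive_eq; rewrite mulrN1 opprK.
Qed.

Lemma gamma_by_parts (s a b : R) : 0 < s -> 0 < a < b ->
  (\int[mu]_(x in `[a, b]) ((x `^ s) * expR (- x))%:E =
   (a `^ s * expR (- a) - b `^ s * expR (- b))%:E +
   s%:E * \int[mu]_(x in `[a, b]) ((x `^ (s - 1)) * expR (- x))%:E)%E.
Proof.
move=> s0 /andP[a0 ab].
have dpow c x : a <= x <= b -> is_derive x 1 (@powR R ^~ c) (c * x `^ (c - 1)).
  by move=> /andP[ax _]; apply: is_derive1_powR; exact: lt_le_trans ax.
have dexp (x : R) : a <= x <= b -> is_derive x 1 (fun x => - expR (- x)) (expR (- x)).
  by move=> _; exact: is_derive_expRN.
rewrite (@integration_by_parts _ (@powR R ^~ s) (fun x => - expR (- x))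
  (fun x => s * x `^ (s - 1)) (fun x => expR (- x)))//; first last.
- move=> x; rewrite in_itv/= => /andP[ax xb]; rewrite derive1E.
  by have := dexp x; rewrite !ltW// => /(_ isT) [].
- exact: derivable_LRcontinuous dexp.
- apply: (@within_continuous_derive _ (fun x => - expR (- x))) => x _.
  by apply: is_derive_eq; rewrite mulrN1.
- move=> x; rewrite in_itv/= => /andP[ax xb]; rewrite derive1E.
  by have := dpow s x; rewrite !ltW// => /(_ isT) [].
- exact: derivable_LRcontinuous (dpow s).
- apply: (@within_continuous_derive _ (fun x => s * ((s - 1) * x `^ (s - 1 - 1)))) => x xab.
  by have := dpow (s - 1) x xab => ?; apply: is_derive_eq.
under [X in (_ - X)%E]eq_integral => x _.
  rewrite (_ : (_ * _)%:E = - (s%:E * ((x `^ (s - 1)) * expR (- x))%:E))%E; last first.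
    by rewrite -EFinM -EFinN mulrN mulrA.
  over.
rewrite integral_ge0N/=; last first.
  by move=> x _; apply: mule_ge0; rewrite ?lee_fin ?(ltW s0)// mulr_ge0 ?powR_ge0 ?expR_ge0.
rewrite oppeK ge0_integralZl//; last 3 first.
- exact: measurable_gamma_integrand.
- by move=> x _; exact: gamma_integrand_ge0.
- by rewrite lee_fin ltW.
by congr (_ + _)%E; congr EFin; ring.
Qed.

(** For an integer p >= s, exp b >= b^(p+1) / (p+1)!. *)
Lemma powR_expRN_le (s : R) : exists2 C, 0 <= C & forall b : R, 1 <= b ->
  b `^ s * expR (- b) <= C / b.
Proof.
pose p := Num.bound s; exists (p.+1)`!%:R => // b b1; have b0 : 0 < b by lra.
have sp : b `^ s <= b ^+ p.
  by rewrite -powR_mulrn ?(ltW b0)// ler_powR//; apply: ltW; exact: unstable.ltr_bound.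
have := expR_ge1Dxn p (ltW b0) => h.
rewrite expRN ler_pdivlMr// mulrAC ler_pdivrMr ?expR_gt0//.
apply: (@le_trans _ _ (b ^+ p.+1)); first by rewrite exprSr ler_pM2r.
have f0 : (0 : R) < (p.+1)`!%:R by rewrite ltr0n fact_gt0.
rewrite mulrC -ler_pdivrMr//; apply: le_trans h; by rewrite lerDr.
Qed.

Lemma boundary_cvg0 (s : R) : 0 < s ->
  (n.+2%:R^-1 `^ s * expR (- n.+2%:R^-1) - n.+2%:R `^ s * expR (- n.+2%:R) : R)
    @[n --> \oo] --> (0 : R).
Proof.
move=> s0; rewrite -[0 in X in _ --> X](subrr 0).
have cvgV : (n.+2%:R^-1 : R) @[n --> \oo] --> (0 : R).
  have := @cvg_harmonic R; rewrite -(cvg_shiftS (@harmonic R)).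
  by apply: cvg_trans; apply: near_eq_cvg; near=> n.
apply: cvgB.
  apply: (@squeeze_cvgr _ _ _ _ (fun=> 0) (fun n => n.+2%:R^-1 `^ s)); last 2 first.
  - exact: cvg_cst.
  - have /cvg_at_rightP := @powR_cvg0 R s s0; apply; split => //.
  near=> n; rewrite mulr_ge0 ?powR_ge0 ?expR_ge0//=.
  by rewrite ler_piMr ?powR_ge0// expR_le1 oppr_le0 invr_ge0.
have [C C0 hC] := powR_expRN_le s.
apply: (@squeeze_cvgr _ _ _ _ (fun=> 0) (fun n => C / n.+2%:R)).
- near=> n; rewrite mulr_ge0 ?powR_ge0 ?expR_ge0//=; apply: hC.
  by rewrite ler1n.
- exact: cvg_cst.
- by rewrite -(mulr0 C); apply: cvgM => //; exact: cvg_cst.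
Unshelve. all: by end_near.
Qed.

(** Compact exhaustion of the half-line, on which integration by parts applies; n + 2 makes the end
    points distinct already for n = 0. *)
Let slab (n : nat) : set R := `[n.+2%:R^-1, n.+2%:R]%classic.

Let slab_mono : {homo slab : n m / (n <= m)%N >-> (n <= m)%O}.
Proof.
move=> n m nm; apply/subsetPset => x; rewrite /slab/= !in_itv/= => /andP[h1 h2].
apply/andP; split.
  by apply: le_trans h1; rewrite lef_pV2 ?posrE// ler_nat ltnS.
by apply: (le_trans h2); rewrite ler_nat ltnS.
Qed.

Let bigcup_slab : \bigcup_n slab n = `]0, +oo[%classic.
Proof.
apply/seteqP; split => x /=.
  move=> [n _]; rewrite /slab/= !in_itv/= andbT => /andP[h _].
  by apply: lt_le_trans h; rewrite invr_gt0.
rewrite in_itv/= andbT => x0.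
pose n := maxn (Num.bound x) (Num.bound x^-1); exists n => //.
rewrite /slab/= in_itv/=; apply/andP; split.
  rewrite invf_ple ?posrE//; apply: ltW; apply: (lt_le_trans (unstable.ltr_bound _)).
  by rewrite ler_nat !leqW// leq_maxr.
apply: ltW; apply: (lt_le_trans (unstable.ltr_bound _)).
by rewrite ler_nat !leqW// leq_maxl.
Qed.

Lemma gammaI_slab_cvg (s : R) :
  (\int[mu]_(x in slab n) ((x `^ (s - 1)) * expR (- x))%:E)%E @[n --> \oo]
  --> gammaI s.
Proof.
rewrite /gammaI -bigcup_slab; apply: ge0_nondecreasing_set_cvg_integral => //.
- by move=> n; exact: measurable_itv.
- by move=> n; exact: measurable_gamma_integrand.
- by move=> n x _; exact: gamma_integrand_ge0.
Qed.

Lemma gammaIS (s : R) : 0 < s -> gammaI (s + 1) = (s%:E * gammaI s)%E.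
Proof.
move=> s0.
have h1 := @gammaI_slab_cvg (s + 1).
suff h2 : (\int[mu]_(x in slab n) ((x `^ (s + 1 - 1)) * expR (- x))%:E)%E
    @[n --> \oo] --> (s%:E * gammaI s)%E.
  exact: (cvg_unique _ h1 h2).
have -> : (fun n => \int[mu]_(x in slab n) ((x `^ (s + 1 - 1)) * expR (- x))%:E)%E =
  (fun n => (n.+2%:R^-1 `^ s * expR (- n.+2%:R^-1) -
     n.+2%:R `^ s * expR (- n.+2%:R))%:E +
   s%:E * \int[mu]_(x in slab n) ((x `^ (s - 1)) * expR (- x))%:E)%E.
  apply/funext => n; rewrite addrK; apply: gamma_by_parts => //.
  rewrite invr_gt0 ltr0n/=; apply: (@lt_trans _ _ 1); last by rewrite ltr1n.
  by rewrite invf_lt1// ltr1n.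
rewrite -[X in _ --> X]add0e; apply: cvgeD => //.
- by apply/cvg_EFin; [near=> n|exact: boundary_cvg0].
- apply: cvgeZl => //; exact: gammaI_slab_cvg.
Unshelve. all: by end_near.
Qed.

Lemma gammaI1 : gammaI 1 = 1%E.
Proof.
rewrite /gammaI; under eq_integral do rewrite subrr powRr0 mul1r.
rewrite integral_itv_obnd_cbnd; last first.
  by apply/measurable_EFinP; apply: measurable_funTS; apply: measurableT_comp.
rewrite (@ge0_continuous_FTC2y _ _ (fun x => - expR (- x)) 0 0)//.
- by rewrite oppr0 expR0 EFinN oppeK add0e.
- apply: continuous_subspaceT => x.
  by apply/differentiable_continuous/derivable1_diffP.
- rewrite -oppr0; apply: cvgN; exact: cvgr_expR.
- apply: cvg_at_right_filter.
  suff : {for 0, continuous (fun x : R => - expR (- x))} by [].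
  apply/differentiable_continuous/derivable1_diffP.
  by have [] := is_derive_expRN 0.
- by move=> x _; rewrite derive1E; have [] := is_derive_expRN x.
Qed.

Lemma gammaI_nat n : gammaI n.+1%:R = (n`!%:R)%:E.
Proof.
elim: n => [|n IH]; first by rewrite gammaI1.
by rewrite -natr1 gammaIS// IH -EFinM -natrM factS.
Qed.

Lemma gammaI_rising (s : R) n : 0 < s ->
  gammaI (n%:R + s) = ((rising s n)%:E * gammaI s)%E.
Proof.
move=> s0; elim: n => [|n IH]; first by rewrite add0r /rising big_ord0 mul1e.
rewrite -natr1 addrAC gammaIS; last by rewrite ltr_wpDl.
by rewrite IH muleA -EFinM risingS mulrC [s + _]addrC.
Qed.

Lemma gammaI_le (s t : R) : 0 < s -> 0 < t < 1 ->
  (gammaI (s + t) <= (s `^ t)%:E * gammaI s)%E.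
Proof.
move=> s0 /andP[t0 t1].
have a0 : 0 <= (1 - t) * s `^ t by rewrite mulr_ge0 ?powR_ge0//; lra.
have b0 : 0 <= t * s `^ (t - 1) by rewrite mulr_ge0 ?powR_ge0// ltW.
(* The right-hand side is the integral of the tangent at s; Gamma(s + 1) = s Gamma(s) merges its two
   terms. *)
have -> : ((s `^ t)%:E * gammaI s =
    ((1 - t) * s `^ t)%:E * gammaI s + (t * s `^ (t - 1))%:E * gammaI (s + 1))%E.
  rewrite gammaIS// muleA -EFinM -ge0_muleDl ?lee_fin//; last first.
    by rewrite mulr_ge0// ltW.
  rewrite -EFinD; congr (_%:E * _)%E.
  rewrite powRB ?lt0r_neq0 ?implybT// powRr1 ?(ltW s0)//; field.
  exact: lt0r_neq0.
rewrite /gammaI -!ge0_integralZl//; try by rewrite lee_fin.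
all: try exact: measurable_gamma_integrand.
all: try by move=> x _; exact: gamma_integrand_ge0.
rewrite -ge0_integralD//=.
all: try by apply: measurable_funeM; exact: measurable_gamma_integrand.
all: try by move=> x _; apply: mule_ge0; [rewrite lee_fin|exact: gamma_integrand_ge0].
apply: ge0_le_integral => //.
- by move=> x _; exact: gamma_integrand_ge0.
- exact: measurable_gamma_integrand.
- by apply: emeasurable_funD; apply: measurable_funeM; exact: measurable_gamma_integrand.
move=> x; rewrite /= in_itv/= andbT => x0.
rewrite -!EFinM -EFinD lee_fin.
have tan := powR_le_tangent s0 (introT andP (conj t0 t1)) x0.
have -> : x `^ (s + t - 1) = x `^ (s - 1) * x `^ t.
  by rewrite -powRD ?(lt0r_neq0 x0) ?implybT//; congr (_ `^ _); ring.
have -> : x `^ (s + 1 - 1) = x `^ (s - 1) * x.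
  by rewrite -{3}(powRr1 (ltW x0)) -powRD ?(lt0r_neq0 x0) ?implybT//; congr (_ `^ _); ring.
set A := (1 - t) * _ in tan *; set B := t * _ in tan *.
have -> : A * (x `^ (s - 1) * expR (- x)) + B * (x `^ (s - 1) * x * expR (- x)) =
  x `^ (s - 1) * expR (- x) * (A + B * x) by ring.
by rewrite mulrAC ler_wpM2l// mulr_ge0 ?powR_ge0 ?expR_ge0.
Qed.

End gamma_integral.

(** * Asymptotics of p_alpha *)

Section power_law_asymptotics.
Context {R : realType} (alpha : R).
Hypotheses (alpha_gt0 : 0 < alpha) (alpha_lt1 : alpha < 1).

(** The product is Gamma(n + 1 - alpha). Wendel's inequality is applied from n + 1 - alpha up to n +
    1 and from n up to n + 1 - alpha. *)
Lemma gamma_rising_bounds n : (0 < n)%N ->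
  n`!%:R <= (n%:R + (1 - alpha)) `^ alpha * (rising (1 - alpha) n * Gamma (1 - alpha)) /\
  rising (1 - alpha) n * Gamma (1 - alpha) <= n%:R `^ (- alpha) * n`!%:R.
Proof.
case: n => // n _; have s0 : 0 < 1 - alpha by move: alpha_lt1; lra.
have s01 : 0 < 1 - alpha < 1.
  by rewrite s0/=; move: alpha_gt0; lra.
(* (1 - alpha) Gamma(1 - alpha) = Gamma(1 + (1 - alpha)) <= Gamma(1) = 1. *)
have fin : gammaI (1 - alpha) \is a fin_num.
  have := gammaI_le ltr01 s01.
  rewrite (gammaI_rising 1 s0) gammaI1 powR1 mul1e /rising big_ord1 addr0.
  move=> h; rewrite ge0_fin_numE ?gammaI_ge0//.
  case: (gammaI (1 - alpha)) (gammaI_ge0 (1 - alpha)) h => [r _ _| |//].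
    exact: ltry.
  by move=> _; rewrite gt0_muley ?lte_fin.
have GE : gammaI (1 - alpha) = (Gamma (1 - alpha))%:E by rewrite -[LHS]fineK.
have rE : gammaI (n.+1%:R + (1 - alpha)) =
   (rising (1 - alpha) n.+1 * Gamma (1 - alpha))%:E.
  by rewrite gammaI_rising// GE -EFinM.
split.
  have t0 : 0 < n.+1%:R + (1 - alpha) by rewrite addr_gt0.
  have := gammaI_le t0 (introT andP (conj alpha_gt0 alpha_lt1)).
  rewrite rE -EFinM.
  have -> : n.+1%:R + (1 - alpha) + alpha = n.+2%:R by rewrite -(natr1 n.+1); ring.
  by rewrite gammaI_nat lee_fin.
have := gammaI_le (ltr0Sn R n) s01.
rewrite rE gammaI_nat -EFinM lee_fin; move/le_trans; apply.
rewrite powRD ?pnatr_eq0 ?implybT// powRr1// factS natrM.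
by rewrite le_eqVlt; apply/orP; left; apply/eqP; ring.
Qed.

Lemma Gamma_gt0 : 0 < Gamma (1 - alpha).
Proof.
have [lo _] := gamma_rising_bounds (isT : (0 < 1)%N).
have s0 : 0 < 1 - alpha by move: alpha_lt1; lra.
move: lo; rewrite (_ : 1`! = 1)%N // /rising big_ord1 addr0 => lo.
have p0 : 0 < (1 + (1 - alpha)) `^ alpha * (1 - alpha).
  by rewrite mulr_gt0// powR_gt0// addr_gt0.
rewrite -(pmulr_rgt0 _ p0) -mulrA; exact: lt_le_trans ltr01 lo.
Qed.

Lemma p_alpha_asymp : (fun k : nat => p_alpha alpha k /
  (alpha * (k%:R `^ (- (alpha + 1))) / Gamma (1 - alpha))) @ \oo --> (1 : R).
Proof.
have g0 := Gamma_gt0.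
(* For k = y + 1 the ratio is at most ((y + 1) / y)^alpha <= 1 + 1 / y, and 1 / y <= 3 / (y + 2) as
   y >= 1; [harmonic k] is 1 / (k + 1). *)
apply: (@squeeze_cvgr _ _ _ _ (fun=> 1) (fun k => 1 + 3 * harmonic k)).
- exists 2%N => // -[//|[//|n]] _ /=.
  have [lo hi] := gamma_rising_bounds (ltn0Sn n).
  set y : R := n.+1%:R in lo hi; have y0 : 0 < y by rewrite ltr0n.
  have y1 : 1 <= y by rewrite ler1n.
  have k0 : 0 < y + 1 by rewrite addr_gt0.
  have f0 : (0 : R) < (n.+1)`!%:R by rewrite ltr0n fact_gt0.
  have -> : p_alpha alpha n.+2 / (alpha * (n.+2%:R `^ (- (alpha + 1))) / Gamma (1 - alpha)) =
     rising (1 - alpha) n.+1 * Gamma (1 - alpha) * (y + 1) `^ alpha / (n.+1)`!%:R.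
    rewrite /p_alpha /= -(natr1 n.+1) -/y (factS n.+1) natrM -(natr1 n.+1) -/y.
    rewrite powRN powRD ?(lt0r_neq0 k0) ?implybT// (powRr1 (ltW k0)).
    by field; rewrite !lt0r_neq0// powR_gt0.
  apply/andP; split.
    rewrite ler_pdivlMr// mul1r; apply: (le_trans lo); rewrite mulrC.
    apply: ler_wpM2l.
      rewrite mulr_ge0 ?(ltW g0)//; apply: prodr_ge0 => i _.
      by rewrite addr_ge0// subr_ge0 ltW.
    apply: ge0_ler_powR; rewrite ?nnegrE ?(ltW k0) ?(ltW alpha_gt0)//.
      by rewrite addr_ge0 ?(ltW y0)// subr_ge0 ltW.
    by rewrite lerD2l gerBl ltW.
  rewrite ler_pdivrMr//.
  apply: (le_trans (ler_wpM2r (powR_ge0 _ _) hi)).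
  rewrite mulrAC ler_pM2r//.
  have -> : y `^ (- alpha) * (y + 1) `^ alpha = ((y + 1) / y) `^ alpha.
    rewrite powRM ?invr_ge0 ?(ltW k0) ?(ltW y0)// mulrC; congr (_ * _).
    by rewrite -(powR_inv1 (ltW y0)) -powRrM mulN1r.
  apply: (@le_trans _ _ ((y + 1) / y)).
    by apply: ler1_powR; rewrite ?(ltW alpha_lt1)// ler_pdivlMr// mul1r lerDl.
  rewrite /harmonic/= -(natr1 n.+2) -(natr1 n.+1) -/y.
  rewrite mulrDl divff ?(lt0r_neq0 y0)// lerD2l mul1r.
  have h3 : 0 < y + 1 + 1 by rewrite addr_gt0.
  by rewrite ler_pdivlMr// mulrC ler_pdivrMr//; lra.
- exact: cvg_cst.
- rewrite -[X in _ --> X]addr0 -(mulr0 (3 : R)); apply: cvgD; first exact: cvg_cst.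
  by apply: cvgM; [exact: cvg_cst|exact: cvg_harmonic].
Qed.

Lemma p_alpha_power_law : power_law (p_alpha alpha) (1 + alpha).
Proof.
split; first by rewrite ltrDl.
have c0 : 0 < alpha / Gamma (1 - alpha) by rewrite divr_gt0// Gamma_gt0.
exists (fun=> alpha / Gamma (1 - alpha)); split.
  split; first exact: nearW.
  move=> lam _; rewrite divff ?lt0r_neq0//; exact: cvg_cst.
have := p_alpha_asymp; apply: cvg_trans; apply: near_eq_cvg; near=> k.
by congr (_ / _); rewrite [1 + alpha]addrC mulrAC.
Unshelve. all: by end_near.
Qed.

End power_law_asymptotics.

Unset Implicit Arguments.

Theorem theorem5p2 (R : realType) (d : measure_display) (T : measurableType d)
  (P : probability T R) (alpha theta : R) (nu : nat -> R)
  (X : nat -> T -> seq nat) :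
  0 < alpha < 1 -> - alpha < theta -> prob_on_pos nu ->
  hollywood P alpha theta nu X ->
  (forall k : nat, (0 < k)%N ->
     {ae P, forall w, (fun n : nat => emp_deg (fun i => X i w) n.+1 k : R) @ \oo
                        --> p_alpha alpha k}) /\
  ((fun k : nat => p_alpha alpha k /
       (alpha * (k%:R `^ (- (alpha + 1))) / Gamma (1 - alpha))) @ \oo --> (1 : R)) /\
  power_law (p_alpha alpha) (1 + alpha) /\ 1 < 1 + alpha < 2.
Proof.
move=> /andP[a0 a1] ta nuP XP; split.
  by move=> k k0; exact: (emp_deg_cvg a0 a1 ta nuP XP k0).
split; first exact: p_alpha_asymp.
by split; [exact: p_alpha_power_law|apply/andP; split; lra].
Qed.
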